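(* Let $k:=-\log\mathrm d\rho$, $K:=[-k,k]\subseteq\widetilde{\mathbb R}$, $y\in{}^{\rho}\mathcal{GC}^\infty(K)$, and $\Delta_y(\omega):=y(k)e^{-ik\omega}-y(-k)e^{ik\omega}$ for $\omega\in\widetilde{\mathbb R}$. If $y'=y$, then $$y(x)=\lim_{h\to+\infty}\mathcal F_h^{-1}\left(\frac{\Delta_y(\omega)}{1-i\omega}\right)(x)\quad\forall x\in\mathring K,$$ where the limit is in the sharp topology.
   Context: Fix a gauge $\rho=(\rho_\varepsilon)_{\varepsilon\in(0,1]}$: a net in $(0,1]$ with $\rho_\varepsilon\to0$ as $\varepsilon\to0^+$. ''For $\varepsilon$ small'' means for all $\varepsilon\in(0,\varepsilon_0]$, for some $\varepsilon_0$. A net $(x_\varepsilon)$ of reals is $\rho$-moderate if for some $N\in\mathbb N$, $|x_\varepsilon|\le\rho_\varepsilon^{-N}$ for $\varepsilon$ small; $(x_\varepsilon)\sim(y_\varepsilon)$ if for every $m\in\mathbb N$, $|x_\varepsilon-y_\varepsilon|\le\rho_\varepsilon^m$ for $\varepsilon$ small. $\widetilde{\mathbb R}$ is the quotient ring of moderate nets by $\sim$, with classes $[x_\varepsilon]$; $\widetilde{\mathbb C}:=\widetilde{\mathbb R}+i\widetilde{\mathbb R}$; $\mathrm d\rho:=[\rho_\varepsilon]$ and $-\log\mathrm d\rho:=[-\log\rho_\varepsilon]$. Order: $[x_\varepsilon]\le[y_\varepsilon]$ iff there are representatives with $x_\varepsilon\le y_\varepsilon$ for all $\varepsilon$; $x<y$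 means $x\le y$ and $y-x$ invertible. $|[x_\varepsilon]|:=[|x_\varepsilon|]$. $[a,b]:=\{x\in\widetilde{\mathbb R}\mid a\le x\le b\}$. The sharp topology has as base the balls $\{x\mid|x-c|<r\}$, $r\in\widetilde{\mathbb R}_{>0}$; $\mathring K$ is the sharp interior. $x$ is infinite if $|x|\ge r$ for all $r\in\mathbb R_{>0}$. Generalized smooth functions: for $X\subseteq\widetilde{\mathbb R}$, $f\in{}^{\rho}\mathcal{GC}^\infty(X)$ means $f:X\to\widetilde{\mathbb C}$ and there is a net $f_\varepsilon\in\mathcal C^\infty(\mathbb R,\mathbb C)$ such that for all $[x_\varepsilon]\in X$: $f([x_\varepsilon])=[f_\varepsilon(x_\varepsilon)]$ and $(f_\varepsilon^{(j)}(x_\varepsilon))$ is $\rho$-moderate for all $j\in\mathbb N$; $f'(x):=[f'_\varepsilon(x_\varepsilon)]$. $\int_a^bf:=[\int_{a_\varepsilon}^{b_\varepsilon}f_\varepsilon]$. For infinite $h\in\widetilde{\mathbb R}_{>0}$ and a GSF $g$ on a set containing $[-h,h]$: $\mathcal F_h^{-1}(g)(x):=\frac1{2\pi}\int_{-h}^hg(\omega)e^{ix\omega}\,\mathrm d\omega$, $x\in\widetilde{\mathbb R}$. Note that $1-i\omega$ is invertible for every $\omega\in\widetilde{\mathbb R}$. $\lim_{h\to+\infty}a(h)=l$ means: $\forall q\in\mathbb N\,\exists\bar h\in\widetilde{\mathbb R}\,\forall h\in\widetilde{\mathbb R},\ h\ge\bar h$: $|a(h)-l|\le\mathrm d\rho^q$.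 *)

(* Defs.v *)
From Stdlib Require Import Reals Lra Lia.
From Stdlib Require Import ClassicalEpsilon FunctionalExtensionality
  PropExtensionality ProofIrrelevance.
From Coquelicot Require Import Coquelicot.

Open Scope R_scope.

(* Nets indexed by (0,1] are encoded as total functions on R; their values
   outside (0,1] never matter. *)

Record gauge := Gauge {
  gauge_net :> R -> R;
  gauge_range : forall e, 0 < e <= 1 -> 0 < gauge_net e <= 1;
  gauge_lim : filterlim gauge_net (at_right 0) (locally 0)
}.

Definition small (P : R -> Prop) : Prop :=
  exists e0, 0 < e0 <= 1 /\ forall e, 0 < e <= e0 -> P e.

Definition moderate (rho : gauge) (x : R -> R) : Prop :=
  exists N : nat, small (fun e => Rabs (x e) <= / (rho e ^ N)).

Definition equivalent (rho : gauge) (x y : R -> R) : Prop :=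
  forall m : nat, small (fun e => Rabs (x e - y e) <= rho e ^ m).

Definition eq_class (rho : gauge) (x : R -> R) : (R -> R) -> Prop :=
  fun x' => moderate rho x' /\ equivalent rho x x'.

(** ** The quotient of the moderate nets *)

Definition Rt (rho : gauge) : Type :=
  { A : (R -> R) -> Prop | exists x, moderate rho x /\ A = eq_class rho x }.

Lemma moderate_const (rho : gauge) (c : R) : moderate rho (fun _ => c).
Proof.
destruct (Req_dec c 0) as [->|Hc].
  exists 0%nat; exists 1; split; [lra|]; intros e He; simpl.
  rewrite Rabs_R0; lra.
assert (Hpos : 0 < / Rabs c) by (apply Rinv_0_lt_compat, Rabs_pos_lt, Hc).
destruct (proj1 (filterlim_locally _ _) (gauge_lim rho) (mkposreal _ Hpos))
  as [d Hd].
exists 1%nat; exists (Rmin 1 (d / 2)); destruct d as [d d0]; simpl in *.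
split; [split; [apply Rmin_pos; lra | apply Rmin_l]|].
intros e [He0 He1].
assert (He2 : e <= d / 2) by (eapply Rle_trans; [apply He1|apply Rmin_r]).
assert (He3 : e <= 1) by (eapply Rle_trans; [apply He1|apply Rmin_l]).
destruct (gauge_range rho e (conj He0 He3)) as [r0 _].
assert (Hb : ball 0 d e).
  change (Rabs (e + - 0) < d); rewrite Ropp_0, Rplus_0_r, Rabs_pos_eq; lra.
specialize (Hd e Hb He0); change (Rabs (rho e + - 0) < / Rabs c) in Hd.
rewrite Ropp_0, Rplus_0_r, Rabs_pos_eq in Hd by lra.
rewrite Rmult_1_r, <- (Rinv_inv (Rabs c)).
apply Rinv_le_contravar; lra.
Qed.

(* [x_e]; the value on a non-moderate net is the class of 0. *)
Definition cls (rho : gauge) (x : R -> R) : Rt rho :=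
  match excluded_middle_informative (moderate rho x) with
  | left Hx => exist _ (eq_class rho x) (ex_intro _ x (conj Hx eq_refl))
  | right _ =>
      exist _ (eq_class rho (fun _ => 0))
        (ex_intro _ (fun _ => 0) (conj (moderate_const rho 0) eq_refl))
  end.

Definition repr {rho : gauge} (X : Rt rho) : R -> R :=
  proj1_sig (constructive_indefinite_description _ (proj2_sig X)).

Declare Scope Rt_scope.
Delimit Scope Rt_scope with Rt.
Bind Scope Rt_scope with Rt.

(* Operations on classes are computed on chosen representatives; the lemmas
   cls_add, ..., cls_expi below give independence of the choice. *)
Definition Rt_const (rho : gauge) (c : R) : Rt rho := cls rho (fun _ => c).
Definition Rt_add {rho : gauge} (X Y : Rt rho) : Rt rho :=
  cls rho (fun e => repr X e + repr Y e).
Definition Rt_mul {rho : gauge} (X Y : Rt rho) : Rt rho :=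
  cls rho (fun e => repr X e * repr Y e).
Definition Rt_opp {rho : gauge} (X : Rt rho) : Rt rho :=
  cls rho (fun e => - repr X e).
Definition Rt_sub {rho : gauge} (X Y : Rt rho) : Rt rho := Rt_add X (Rt_opp Y).
Definition Rt_abs {rho : gauge} (X : Rt rho) : Rt rho :=
  cls rho (fun e => Rabs (repr X e)).
Fixpoint Rt_pow {rho : gauge} (X : Rt rho) (q : nat) : Rt rho :=
  match q with O => Rt_const rho 1 | S q => Rt_mul X (Rt_pow X q) end.

Definition Rt_le {rho : gauge} (X Y : Rt rho) : Prop :=
  exists x y : R -> R,
    moderate rho x /\ moderate rho y /\ X = cls rho x /\ Y = cls rho y /\
    forall e, 0 < e <= 1 -> x e <= y e.
Definition Rt_invertible {rho : gauge} (X : Rt rho) : Prop :=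
  exists Y, Rt_mul X Y = Rt_const rho 1.
Definition Rt_lt {rho : gauge} (X Y : Rt rho) : Prop :=
  Rt_le X Y /\ Rt_invertible (Rt_sub Y X).

Notation "0" := (Rt_const _ 0%R) : Rt_scope.
Notation "1" := (Rt_const _ 1%R) : Rt_scope.
Infix "+" := Rt_add : Rt_scope.
Infix "*" := Rt_mul : Rt_scope.
Notation "- x" := (Rt_opp x) : Rt_scope.
Infix "-" := Rt_sub : Rt_scope.
Infix "^" := Rt_pow : Rt_scope.
Infix "<=" := Rt_le : Rt_scope.
Infix "<" := Rt_lt : Rt_scope.

Definition drho (rho : gauge) : Rt rho := cls rho rho.
Definition neg_log_drho (rho : gauge) : Rt rho := cls rho (fun e => - ln (rho e)).

Definition Rt_itv {rho : gauge} (a b : Rt rho) : Rt rho -> Prop :=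
  fun x => (a <= x)%Rt /\ (x <= b)%Rt.

Definition sharp_ball {rho : gauge} (c r : Rt rho) : Rt rho -> Prop :=
  fun x => (Rt_abs (x - c) < r)%Rt.
Definition sharp_open {rho : gauge} (U : Rt rho -> Prop) : Prop :=
  forall x, U x -> exists c r, (0 < r)%Rt /\ sharp_ball c r x /\
    forall z, sharp_ball c r z -> U z.
Definition sharp_interior {rho : gauge} (A : Rt rho -> Prop) : Rt rho -> Prop :=
  fun x => exists U, sharp_open U /\ (forall z, U z -> A z) /\ U x.

(** ** Generalized complex numbers *)

(* (a, b) stands for a + i b. *)
Definition Ct (rho : gauge) : Type := (Rt rho * Rt rho)%type.

Declare Scope Ct_scope.
Delimit Scope Ct_scope with Ct.
Bind Scope Ct_scope with Ct.

Definition ccls (rho : gauge) (z : R -> C) : Ct rho :=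
  (cls rho (fun e => Re (z e)), cls rho (fun e => Im (z e))).
Definition crepr {rho : gauge} (Z : Ct rho) : R -> C :=
  fun e => (repr (fst Z) e, repr (snd Z) e).

Definition Ct_of_Rt {rho : gauge} (x : Rt rho) : Ct rho := (x, 0%Rt).
Definition Ct_i (rho : gauge) : Ct rho := (0%Rt, 1%Rt).
Definition Ct_add {rho : gauge} (u v : Ct rho) : Ct rho :=
  ((fst u + fst v)%Rt, (snd u + snd v)%Rt).
Definition Ct_opp {rho : gauge} (u : Ct rho) : Ct rho :=
  ((- fst u)%Rt, (- snd u)%Rt).
Definition Ct_sub {rho : gauge} (u v : Ct rho) : Ct rho := Ct_add u (Ct_opp v).
Definition Ct_mul {rho : gauge} (u v : Ct rho) : Ct rho :=
  ((fst u * fst v - snd u * snd v)%Rt, (fst u * snd v + snd u * fst v)%Rt).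
(* The multiplicative inverse of an invertible u; unspecified otherwise. *)
Definition Ct_inv {rho : gauge} (u : Ct rho) : Ct rho :=
  epsilon (inhabits (Ct_of_Rt 0%Rt)) (fun v => Ct_mul u v = Ct_of_Rt 1%Rt).
Definition Ct_div {rho : gauge} (u v : Ct rho) : Ct rho := Ct_mul u (Ct_inv v).
Definition Ct_abs {rho : gauge} (u : Ct rho) : Rt rho :=
  cls rho (fun e => Cmod (crepr u e)).
(* e^{i t} *)
Definition Ct_expi {rho : gauge} (t : Rt rho) : Ct rho :=
  ccls rho (fun e => (cos (repr t e), sin (repr t e))).

Infix "+" := Ct_add : Ct_scope.
Infix "*" := Ct_mul : Ct_scope.
Notation "- x" := (Ct_opp x) : Ct_scope.
Infix "-" := Ct_sub : Ct_scope.
Infix "/" := Ct_div : Ct_scope.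

(** ** Generalized smooth functions *)

Definition Cderive_n (f : R -> C) (j : nat) (t : R) : C :=
  (Derive_n (fun s => Re (f s)) j t, Derive_n (fun s => Im (f s)) j t).
Definition Csmooth (f : R -> C) : Prop :=
  forall (j : nat) (t : R),
    ex_derive_n (fun s => Re (f s)) j t /\ ex_derive_n (fun s => Im (f s)) j t.

(* A map X -> Ct is a total function whose values outside X are irrelevant. *)
Definition defines {rho : gauge} (X : Rt rho -> Prop) (fe : R -> R -> C)
    (f : Rt rho -> Ct rho) : Prop :=
  (forall e, 0 < e <= 1 -> Csmooth (fe e)) /\
  forall x : R -> R, moderate rho x -> X (cls rho x) ->
    f (cls rho x) = ccls rho (fun e => fe e (x e)) /\
    forall j : nat, moderate rho (fun e => Cmod (Cderive_n (fe e) j (x e))).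

Definition GSF {rho : gauge} (X : Rt rho -> Prop) (f : Rt rho -> Ct rho) : Prop :=
  exists fe : R -> R -> C, defines X fe f.

(* Some net defining f on X. On the domains used here the derivative and the
   integral of a generalized smooth function do not depend on the choice. *)
Definition defining_net {rho : gauge} (X : Rt rho -> Prop) (f : Rt rho -> Ct rho) :
    R -> R -> C :=
  epsilon (inhabits (fun _ _ => RtoC 0)) (fun fe => defines X fe f).

Definition GSF_derive {rho : gauge} (X : Rt rho -> Prop) (f : Rt rho -> Ct rho)
    (x : Rt rho) : Ct rho :=
  ccls rho (fun e => Cderive_n (defining_net X f e) 1 (repr x e)).

Definition GSF_int {rho : gauge} (f : Rt rho -> Ct rho) (a b : Rt rho) : Ct rho :=
  ccls rho (fun e =>
    RInt (V := C_R_CompleteNormedModule) (defining_net (Rt_itv a b) f e)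
      (repr a e) (repr b e)).

Definition inv_Fourier {rho : gauge} (h : Rt rho) (g : Rt rho -> Ct rho)
    (x : Rt rho) : Ct rho :=
  (Ct_of_Rt (Rt_const rho (1 / (2 * PI)))
   * GSF_int (fun w => g w * Ct_expi (x * w)%Rt) (- h)%Rt h)%Ct.

Definition lim_infty {rho : gauge} (a : Rt rho -> Ct rho) (l : Ct rho) : Prop :=
  forall q : nat, exists hbar : Rt rho, forall h : Rt rho, (hbar <= h)%Rt ->
    (Ct_abs (a h - l)%Ct <= drho rho ^ q)%Rt.

Definition Delta_bd {rho : gauge} (k : Rt rho) (y : Rt rho -> Ct rho) (w : Rt rho) :
    Ct rho :=
  (y k * Ct_expi (- (k * w))%Rt - y (- k)%Rt * Ct_expi (k * w)%Rt)%Ct.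

(** ** Independence of representatives *)

Lemma small_and (P Q S : R -> Prop) :
  small P -> small Q -> (forall e, 0 < e <= 1 -> P e -> Q e -> S e) -> small S.
Proof.
intros [d [Hd HP]] [d' [Hd' HQ]] H; exists (Rmin d d'); split.
  split; [apply Rmin_pos; lra | pose proof (Rmin_l d d'); lra].
intros e He; pose proof (Rmin_l d d'); pose proof (Rmin_r d d').
apply H; [lra | apply HP; lra | apply HQ; lra].
Qed.

Lemma small_imp (P Q : R -> Prop) :
  small P -> (forall e, 0 < e <= 1 -> P e -> Q e) -> small Q.
Proof. intros HP H; apply (small_and P P); auto. Qed.

Lemma gauge_small (rho : gauge) (c : R) : 0 < c -> small (fun e => rho e <= c).
Proof.
intros Hc; destruct (moderate_const rho (/ c)) as [N HN].
destruct (proj1 (filterlim_locally _ _) (gauge_lim rho) (mkposreal _ Hc))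
  as [[d d0] Hd]; simpl in *.
exists (Rmin 1 (d / 2)); split; [split; [apply Rmin_pos; lra | apply Rmin_l]|].
intros e [He0 He1].
assert (He2 : e <= d / 2) by (eapply Rle_trans; [apply He1|apply Rmin_r]).
assert (Hb : ball 0 d e).
  change (Rabs (e + - 0) < d); rewrite Ropp_0, Rplus_0_r, Rabs_pos_eq; lra.
specialize (Hd e Hb He0); change (Rabs (rho e + - 0) < c) in Hd.
rewrite Ropp_0, Rplus_0_r in Hd; pose proof (Rle_abs (rho e)); lra.
Qed.

Lemma gauge_pow (rho : gauge) (n : nat) (e : R) :
  0 < e <= 1 -> 0 < rho e ^ n <= 1.
Proof.
intros He; pose proof (gauge_range rho e He) as Hr; split.
  apply pow_lt; lra.
rewrite <- (pow1 n); apply pow_incr; lra.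
Qed.

Lemma equivalent_refl (rho : gauge) (x : R -> R) : equivalent rho x x.
Proof.
intros m; exists 1; split; [lra|]; intros e He.
unfold Rminus; rewrite Rplus_opp_r, Rabs_R0; apply Rlt_le, gauge_pow, He.
Qed.

Lemma equivalent_sym (rho : gauge) (x y : R -> R) :
  equivalent rho x y -> equivalent rho y x.
Proof.
intros H m; apply (small_imp _ _ (H m)); intros e He He'.
rewrite Rabs_minus_sym; exact He'.
Qed.

Lemma equivalent_dom (rho : gauge) (x y x' y' B : R -> R) :
  moderate rho B -> equivalent rho x y ->
  (forall e, 0 < e <= 1 ->
    Rabs (x' e - y' e) <= Rabs (B e) * Rabs (x e - y e)) ->
  equivalent rho x' y'.
Proof.
intros [N HN] H HB m; apply (small_and _ _ _ HN (H (N + m)%nat)).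
intros e He H1 H2; eapply Rle_trans; [apply HB, He|].
destruct (gauge_pow rho N e He) as [HN0 _].
apply Rle_trans with (/ rho e ^ N * rho e ^ (N + m)).
  apply Rmult_le_compat; auto using Rabs_pos.
rewrite pow_add, <- Rmult_assoc, Rinv_l by lra; lra.
Qed.

Lemma moderate_equivalent (rho : gauge) (x y : R -> R) :
  moderate rho x -> equivalent rho x y -> moderate rho y.
Proof.
intros [N HN] H; exists (S N).
apply (small_and _ _ _
  (small_and _ _ _ HN (H 0%nat) (fun e _ H1 H2 => conj H1 H2))
  (gauge_small rho (1 / 2) ltac:(lra))).
intros e He [H1 H2] H3; simpl in *.
destruct (gauge_pow rho N e He) as [HN0 HN1].
pose proof (gauge_range rho e He) as Hr.
rewrite Rinv_mult.
assert (Hi : 1 <= / rho e ^ N) by (rewrite <- Rinv_1; apply Rinv_le_contravar; lra).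
assert (H2r : 2 <= / rho e).
  rewrite <- (Rinv_inv 2); apply Rinv_le_contravar; lra.
assert (Hy : Rabs (y e) <= Rabs (x e) + Rabs (x e - y e)).
  replace (y e) with (x e + - (x e - y e)) at 1 by ring.
  eapply Rle_trans; [apply Rabs_triang|]; rewrite Rabs_Ropp; lra.
apply Rle_trans with (2 * / rho e ^ N); [lra|].
apply Rmult_le_compat_r; lra.
Qed.

Lemma equivalent_trans (rho : gauge) (x y z : R -> R) :
  equivalent rho x y -> equivalent rho y z -> equivalent rho x z.
Proof.
intros H H' m; apply (small_and _ _ _
  (small_and _ _ _ (H (S m)) (H' (S m)) (fun e _ H1 H2 => conj H1 H2))
  (gauge_small rho (1 / 2) ltac:(lra))).
intros e He [H1 H2] H3; simpl in *.
destruct (gauge_pow rho m e He) as [Hm _].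
replace (x e - z e) with ((x e - y e) + (y e - z e)) by ring.
eapply Rle_trans; [apply Rabs_triang|].
assert (rho e * rho e ^ m <= 1 / 2 * rho e ^ m) by (apply Rmult_le_compat_r; lra).
lra.
Qed.

Lemma moderate_mul (rho : gauge) (x y : R -> R) :
  moderate rho x -> moderate rho y -> moderate rho (fun e => x e * y e).
Proof.
intros [N HN] [M HM]; exists (N + M)%nat; apply (small_and _ _ _ HN HM).
intros e _ H1 H2; rewrite pow_add, Rinv_mult, Rabs_mult.
apply Rmult_le_compat; auto using Rabs_pos.
Qed.

Lemma moderate_le (rho : gauge) (x y : R -> R) :
  moderate rho y -> (forall e, 0 < e <= 1 -> Rabs (x e) <= Rabs (y e)) ->
  moderate rho x.
Proof.
intros [N HN] H; exists N; apply (small_imp _ _ HN).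
intros e He H1; pose proof (H e He); lra.
Qed.

Lemma moderate_add (rho : gauge) (x y : R -> R) :
  moderate rho x -> moderate rho y -> moderate rho (fun e => x e + y e).
Proof.
intros [N HN] [M HM]; exists (S (N + M)); apply (small_and _ _ _
  (small_and _ _ _ HN HM (fun e _ H1 H2 => conj H1 H2))
  (gauge_small rho (1 / 2) ltac:(lra))).
intros e He [H1 H2] H3.
pose proof (gauge_range rho e He) as Hr.
assert (H2r : 2 <= / rho e).
  rewrite <- (Rinv_inv 2); apply Rinv_le_contravar; lra.
assert (Hi : forall n, 1 <= / rho e ^ n).
  intros n; pose proof (gauge_pow rho n e He).
  rewrite <- Rinv_1; apply Rinv_le_contravar; lra.
simpl; rewrite Rinv_mult, pow_add, Rinv_mult.
pose proof (Hi N) as HiN; pose proof (Hi M) as HiM.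
eapply Rle_trans; [apply Rabs_triang|].
set (a := / rho e ^ N) in *; set (b := / rho e ^ M) in *.
apply Rle_trans with (2 * (a * b)); [nra|].
apply Rmult_le_compat_r; nra.
Qed.

Lemma moderate_opp (rho : gauge) (x : R -> R) :
  moderate rho x -> moderate rho (fun e => - x e).
Proof. intros H; apply (moderate_le _ _ _ H); intros; rewrite Rabs_Ropp; lra. Qed.

Lemma moderate_abs (rho : gauge) (x : R -> R) :
  moderate rho x -> moderate rho (fun e => Rabs (x e)).
Proof. intros H; apply (moderate_le _ _ _ H); intros; rewrite Rabs_Rabsolu; lra. Qed.

Lemma moderate_rho (rho : gauge) : moderate rho rho.
Proof.
apply (moderate_le _ _ _ (moderate_const rho 1)); intros e He.
pose proof (gauge_range rho e He); rewrite !Rabs_pos_eq; lra.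
Qed.

Lemma moderate_neg_log (rho : gauge) : moderate rho (fun e => - ln (rho e)).
Proof.
exists 1%nat; exists 1; split; [lra|]; intros e He.
pose proof (gauge_range rho e He) as Hr.
rewrite pow_1, <- ln_Rinv by lra.
assert (Hi : 1 <= / rho e) by (rewrite <- Rinv_1; apply Rinv_le_contravar; lra).
assert (Hl : 0 <= ln (/ rho e)) by (rewrite <- ln_1; apply ln_le; lra).
rewrite Rabs_pos_eq by lra.
pose proof (exp_ineq1_le (ln (/ rho e))) as He1; rewrite exp_ln in He1; lra.
Qed.

Lemma Rt_eq (rho : gauge) (X Y : Rt rho) : proj1_sig X = proj1_sig Y -> X = Y.
Proof.
destruct X as [A HA], Y as [B HB]; simpl; intros <-.
f_equal; apply proof_irrelevance.
Qed.

Lemma cls_val (rho : gauge) (x : R -> R) :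
  moderate rho x -> proj1_sig (cls rho x) = eq_class rho x.
Proof.
intros H; unfold cls; destruct excluded_middle_informative; [reflexivity|contradiction].
Qed.

Lemma cls_eq (rho : gauge) (x y : R -> R) :
  moderate rho x -> moderate rho y -> (cls rho x = cls rho y <-> equivalent rho x y).
Proof.
intros Hx Hy; split; intros H.
  apply (f_equal (@proj1_sig _ _)) in H; rewrite !cls_val in H by assumption.
  assert (Hc : eq_class rho x y).
    rewrite H; split; [exact Hy | apply equivalent_refl].
  exact (proj2 Hc).
apply Rt_eq; rewrite !cls_val by assumption.
apply functional_extensionality; intros z; apply propositional_extensionality.
unfold eq_class; split; intros [Hz Hxz]; split; trivial.
  eapply equivalent_trans; [apply equivalent_sym|]; eassumption.
eapply equivalent_trans; eassumption.
Qed.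

Lemma repr_moderate (rho : gauge) (X : Rt rho) : moderate rho (repr X).
Proof. unfold repr; destruct constructive_indefinite_description; simpl; tauto. Qed.

Lemma cls_repr (rho : gauge) (X : Rt rho) : cls rho (repr X) = X.
Proof.
apply Rt_eq; rewrite cls_val by apply repr_moderate.
unfold repr; destruct constructive_indefinite_description as [x [Hx E]]; simpl.
symmetry; exact E.
Qed.

Lemma repr_cls (rho : gauge) (x : R -> R) :
  moderate rho x -> equivalent rho (repr (cls rho x)) x.
Proof.
intros H; apply cls_eq; auto using repr_moderate; apply cls_repr.
Qed.

Lemma cls_add (rho : gauge) (x y : R -> R) :
  moderate rho x -> moderate rho y ->
  (cls rho x + cls rho y)%Rt = cls rho (fun e => x e + y e).
Proof.
intros Hx Hy; apply cls_eq; auto using moderate_add, repr_moderate.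
apply equivalent_trans with (fun e => x e + repr (cls rho y) e).
  apply (equivalent_dom rho _ _ _ _ (fun _ => 1) (moderate_const rho 1)
    (repr_cls rho x Hx)); intros e _; rewrite Rabs_R1, Rmult_1_l.
  apply Req_le; f_equal; ring.
apply (equivalent_dom rho _ _ _ _ (fun _ => 1) (moderate_const rho 1)
  (repr_cls rho y Hy)); intros e _; rewrite Rabs_R1, Rmult_1_l.
apply Req_le; f_equal; ring.
Qed.

Lemma cls_mul (rho : gauge) (x y : R -> R) :
  moderate rho x -> moderate rho y ->
  (cls rho x * cls rho y)%Rt = cls rho (fun e => x e * y e).
Proof.
intros Hx Hy; apply cls_eq; auto using moderate_mul, repr_moderate.
apply equivalent_trans with (fun e => x e * repr (cls rho y) e).
  apply (equivalent_dom rho _ _ _ _ _ (repr_moderate rho (cls rho y))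
    (repr_cls rho x Hx)); intros e _; rewrite <- Rabs_mult.
  apply Req_le; f_equal; ring.
apply (equivalent_dom rho _ _ _ _ _ Hx (repr_cls rho y Hy)).
intros e _; rewrite <- Rabs_mult; apply Req_le; f_equal; ring.
Qed.

Lemma cls_opp (rho : gauge) (x : R -> R) :
  moderate rho x -> (- cls rho x)%Rt = cls rho (fun e => - x e).
Proof.
intros Hx; apply cls_eq; auto using moderate_opp, repr_moderate.
apply (equivalent_dom rho _ _ _ _ (fun _ => 1) (moderate_const rho 1)
  (repr_cls rho x Hx)); intros e _; rewrite Rabs_R1, Rmult_1_l, <- Rabs_Ropp.
apply Req_le; f_equal; ring.
Qed.

Lemma cls_abs (rho : gauge) (x : R -> R) :
  moderate rho x -> Rt_abs (cls rho x) = cls rho (fun e => Rabs (x e)).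
Proof.
intros Hx; apply cls_eq; auto using moderate_abs, repr_moderate.
apply (equivalent_dom rho _ _ _ _ (fun _ => 1) (moderate_const rho 1)
  (repr_cls rho x Hx)); intros e _; rewrite Rabs_R1, Rmult_1_l.
apply Rabs_triang_inv2.
Qed.

Lemma Rt_ring (rho : gauge) :
  ring_theory 0%Rt 1%Rt (@Rt_add rho) Rt_mul Rt_sub Rt_opp eq.
Proof.
split; intros; try reflexivity;
  repeat match goal with X : Rt rho |- _ =>
    rewrite <- (cls_repr rho X);
    let x := fresh in let Hx := fresh in
    pose proof (repr_moderate rho X) as Hx; set (x := repr X) in *;
    clearbody x; clear X
  end;
  unfold Rt_const, Rt_sub;
  repeat first
    [ rewrite cls_add by auto using moderate_add, moderate_mul, moderate_opp, moderate_const
    | rewrite cls_mul by auto using moderate_add, moderate_mul, moderate_opp, moderate_const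
    | rewrite cls_opp by auto using moderate_add, moderate_mul, moderate_opp, moderate_const ];
  f_equal; apply functional_extensionality; intros e; ring.
Qed.

Lemma Cmod_triang_inv (u v : C) : Rabs (Cmod u - Cmod v) <= Cmod (u - v)%C.
Proof.
pose proof (Cmod_triangle (u - v) v) as H1.
pose proof (Cmod_triangle (v - u) u) as H2.
replace (u - v + v)%C with u in H1 by ring.
replace (v - u + u)%C with v in H2 by ring.
replace (v - u)%C with (- (u - v))%C in H2 by ring.
rewrite Cmod_opp in H2; apply Rabs_le; lra.
Qed.

Lemma moderate_Cmod (rho : gauge) (z : R -> C) :
  moderate rho (fun e => Re (z e)) -> moderate rho (fun e => Im (z e)) ->
  moderate rho (fun e => Cmod (z e)).
Proof.
intros H1 H2.
apply (moderate_le _ _ _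
  (moderate_add _ _ _ (moderate_abs _ _ H1) (moderate_abs _ _ H2))).
intros e _; rewrite Rabs_pos_eq by apply Cmod_ge_0.
rewrite Rabs_pos_eq by (apply Rplus_le_le_0_compat; apply Rabs_pos).
unfold Cmod, Re, Im; destruct (z e) as [a b]; simpl.
apply Rsqr_incr_0_var;
  [|apply Rplus_le_le_0_compat; apply Rabs_pos].
pose proof (Rabs_pos a); pose proof (Rabs_pos b).
assert (Ha : Rabs a * Rabs a = a * a) by (rewrite <- Rabs_mult; apply Rabs_pos_eq; nra).
assert (Hb : Rabs b * Rabs b = b * b) by (rewrite <- Rabs_mult; apply Rabs_pos_eq; nra).
rewrite Rsqr_sqrt by nra; unfold Rsqr; nra.
Qed.

Lemma ccls_abs (rho : gauge) (z : R -> C) :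
  moderate rho (fun e => Re (z e)) -> moderate rho (fun e => Im (z e)) ->
  Ct_abs (ccls rho z) = cls rho (fun e => Cmod (z e)).
Proof.
intros H1 H2; unfold Ct_abs, ccls, crepr; simpl.
assert (E1 := repr_cls rho _ H1); assert (E2 := repr_cls rho _ H2).
apply cls_eq.
- apply moderate_Cmod; apply repr_moderate.
- apply moderate_Cmod; assumption.
- revert E1 E2; generalize (repr (cls rho (fun e => Re (z e)))) as a.
  generalize (repr (cls rho (fun e => Im (z e)))) as b; intros b a E1 E2.
  apply equivalent_trans with (fun e => Cmod (Re (z e), b e)).
    apply (equivalent_dom rho _ _ _ _ (fun _ => 1) (moderate_const rho 1) E1).
    intros e _; rewrite Rabs_R1, Rmult_1_l.
    eapply Rle_trans; [apply Cmod_triang_inv|].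
    rewrite <- Cmod_R; apply Req_le; f_equal.
    apply injective_projections; simpl; unfold Re; ring.
  apply (equivalent_dom rho _ _ _ _ (fun _ => 1) (moderate_const rho 1) E2).
  intros e _; rewrite Rabs_R1, Rmult_1_l.
  eapply Rle_trans; [apply Cmod_triang_inv|].
  unfold Cminus, Cplus, Copp; simpl; fold (Re (z e)) (Im (z e)).
  rewrite Rplus_opp_r; unfold Cmod; simpl.
  rewrite <- (sqrt_Rsqr_abs (b e - Im (z e))); apply Req_le; f_equal.
  unfold Rsqr; ring.
Qed.

Lemma cls_expi (rho : gauge) (t : R -> R) :
  moderate rho t -> Ct_expi (cls rho t) = ccls rho (fun e => (cos (t e), sin (t e))).
Proof.
intros Ht; unfold Ct_expi, ccls; simpl.
assert (Mc : forall s, moderate rho (fun e => cos (s e))).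
  intros s; apply (moderate_le _ _ _ (moderate_const rho 1)); intros e _.
  rewrite Rabs_R1; apply Rabs_le; apply COS_bound.
assert (Ms : forall s, moderate rho (fun e => sin (s e))).
  intros s; apply (moderate_le _ _ _ (moderate_const rho 1)); intros e _.
  rewrite Rabs_R1; apply Rabs_le; apply SIN_bound.
f_equal; apply cls_eq; trivial;
  apply (equivalent_dom rho _ _ _ _ (fun _ => 1) (moderate_const rho 1)
    (repr_cls rho t Ht)); intros e _; rewrite Rabs_R1, Rmult_1_l;
  set (a := repr _ e); set (b := t e).
- destruct (MVT_abs cos (fun u => - sin u) b a) as [c [Hc _]].
    intros; apply derivable_pt_lim_cos.
  rewrite Hc, Rabs_Ropp; rewrite <- (Rmult_1_l (Rabs (a - b))) at 2.
  apply Rmult_le_compat_r; [apply Rabs_pos | apply Rabs_le, SIN_bound].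
- destruct (MVT_abs sin cos b a) as [c [Hc _]].
    intros; apply derivable_pt_lim_sin.
  rewrite Hc; rewrite <- (Rmult_1_l (Rabs (a - b))) at 2.
  apply Rmult_le_compat_r; [apply Rabs_pos | apply Rabs_le, COS_bound].
Qed.

(* Main.v *)
Require Import Defs.
From Stdlib Require Import Reals Lra Lia Classical ClassicalEpsilon FunctionalExtensionality.
From Coquelicot Require Import Coquelicot.

(** The equation y' = y holds up to a negligible error uniformly on [-k, k], so
    y(t) = e^{t-x} y(x) there: although k is infinite, e^{2k} = rho^{-2} is
    moderate.  Hence, with p = k - x and q = k + x, the truncated transform equals
    y(x)/(2 pi) * (J(p) - J(-q)), where J(s) = e^s I(s) and I(s) is the integral of
    e^{-isw}/(1 - iw) over [-h, h].  Since J' = 2 e^s sin(hs)/s, integration by parts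
    shows that J(s) is O(1/h) for s < 0 (J vanishes at -oo) and nearly constant for
    s > 0.  The constant is 2 pi, because (I(s) + I(-s))/2 is close to
    2 atan h when s is close to 0; comparing at s = 1/(hr) gives an error O(r) as
    soon as h r^3 >= 1.  A sharp interior point has p, q >= rho^N, so taking r a
    power of rho makes everything small for h above some power of 1/rho. *)

(** * A truncated Fourier inversion estimate *)

(** Every estimate has explicit constants: [p] may be as small as a power of [rho] and as large as
    [2k], and errors are multiplied by [e^p], up to [rho^{-2}]. A limit in [h] for each fixed [s]
    would give no threshold for [h] that is moderate as [e] varies. The jump of [J] at 0 cannot be
    read off by bounding [J'], which is of order [h] there; hence the detour through the even part
    of [I]. The comparison point [d = 1/(hr)] is a compromise: it is far enough from 0 for the
    oscillation to have settled up to [1/(hd) = r], yet close enough that replacing [cos (d w)] by 1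
    on [[-h, h]] costs a multiple of [h d^2 = 1/(h r^2)], which is at most [r] exactly when
    [h r^3 >= 1]. *)

Lemma Rabs_sub_le_of_derive (f g df dg : R -> R) (a b : R) :
  a <= b ->
  (forall t, a <= t <= b -> is_derive f t (df t)) ->
  (forall t, a <= t <= b -> is_derive g t (dg t)) ->
  (forall t, a <= t <= b -> Rabs (df t) <= dg t) ->
  Rabs (f b - f a) <= g b - g a.
Proof.
intros Hab Hf Hg Hd.
assert (M : forall F dF : R -> R, (forall t, a <= t <= b -> is_derive F t (dF t)) ->
   (forall t, a <= t <= b -> 0 <= dF t) -> F a <= F b).
  intros F dF HF Hp.
  destruct (MVT_gen F a b dF) as [c [Hc E]];
    rewrite ?Rmin_left, ?Rmax_right in * by lra.
  - intros t Ht; apply HF; lra.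
  - intros t Ht; apply continuity_pt_filterlim, (ex_derive_continuous F).
    exists (dF t); apply HF; lra.
  - pose proof (Hp c Hc); nra.
(* Both [g - f] and [g + f] are nondecreasing. The later uses supply an explicit antiderivative [g],
   so no integral of the bound is ever formed. *)
pose proof (M (fun t => g t - f t) (fun t => dg t - df t)) as M1.
pose proof (M (fun t => g t + f t) (fun t => dg t + df t)) as M2.
cbv beta in *; apply Rabs_le; split.
- cut (g a + f a <= g b + f b); [lra|]; apply M2; intros t Ht.
    apply (is_derive_plus g f t (dg t) (df t)); auto.
  specialize (Hd t Ht); pose proof (Rle_abs (- df t)); rewrite Rabs_Ropp in *; lra.
- cut (g a - f a <= g b - f b); [lra|]; apply M1; intros t Ht.
    apply (is_derive_minus g f t (dg t) (df t)); auto.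
  specialize (Hd t Ht); pose proof (Rle_abs (df t)); lra.
Qed.

(** The endpoints are left unordered because it is applied to values of representatives, which need
    not be ordered at every [e]. *)
Lemma Rabs_RInt_le_const_gen (f : R -> R) (a b M : R) :
  ex_RInt f a b ->
  (forall t, Rmin a b <= t <= Rmax a b -> Rabs (f t) <= M) ->
  Rabs (RInt f a b) <= Rabs (b - a) * M.
Proof.
intros Hf HM; destruct (Rle_dec a b) as [Hab|Hab].
- rewrite Rmin_left, Rmax_right in HM by exact Hab.
  rewrite (Rabs_pos_eq (b - a)) by lra; apply abs_RInt_le_const; assumption.
- rewrite Rmin_right, Rmax_left in HM by lra.
  apply ex_RInt_swap in Hf.
  rewrite <- (opp_RInt_swap f b a) by exact Hf; change (opp (RInt f b a)) with (- RInt f b a).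
  rewrite Rabs_Ropp, (Rabs_left (b - a)) by lra.
  replace (- (b - a)) with (a - b) by ring.
  apply abs_RInt_le_const; [lra | exact Hf | exact HM].
Qed.

(* The real and imaginary parts of [e^{-isw} / (1 - iw)]. *)
Definition ker_re (s w : R) : R := (cos (s * w) + w * sin (s * w)) / (1 + w * w).
Definition ker_im (s w : R) : R := (w * cos (s * w) - sin (s * w)) / (1 + w * w).

Lemma one_plus_sqr_neq0 (w : R) : 1 + w * w <> 0.
Proof. nra. Qed.

Lemma continuous_ker_re (s w : R) : continuous (ker_re s) w.
Proof.
apply (ex_derive_continuous (ker_re s)); unfold ker_re; auto_derive.
apply one_plus_sqr_neq0.
Qed.

Lemma continuous_ker_im (s w : R) : continuous (ker_im s) w.
Proof.
apply (ex_derive_continuous (ker_im s)); unfold ker_im; auto_derive.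
apply one_plus_sqr_neq0.
Qed.

Lemma ex_RInt_ker_re (s a b : R) : ex_RInt (ker_re s) a b.
Proof. apply (ex_RInt_continuous (ker_re s)); intros; apply continuous_ker_re. Qed.

Lemma ex_RInt_ker_im (s a b : R) : ex_RInt (ker_im s) a b.
Proof. apply (ex_RInt_continuous (ker_im s)); intros; apply continuous_ker_im. Qed.

Definition int_ker (h s : R) : R := RInt (ker_re s) (- h) h.

(** The kernel takes conjugate values at [w] and [-w], so its imaginary part is odd. *)
Lemma RInt_ker_im (h s : R) : RInt (ker_im s) (- h) h = 0.
Proof.
pose proof (RInt_correct _ _ _ (ex_RInt_ker_im s (- h) h)) as E.
apply is_RInt_swap in E; rewrite <- (Ropp_involutive h) in E at 1.
apply is_RInt_comp_opp in E.
apply (is_RInt_ext _ (ker_im s)) in E.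
  pose proof (is_RInt_unique (V := R_CompleteNormedModule) _ _ _ _ E) as E'.
  change (RInt (ker_im s) (- h) h = - RInt (ker_im s) (- h) h) in E'; lra.
intros w _; unfold ker_im, opp; simpl.
replace (s * - w) with (- (s * w)) by ring; rewrite cos_neg, sin_neg.
field; apply one_plus_sqr_neq0.
Qed.

Lemma Rabs_ker_re_le (s w : R) : Rabs (ker_re s w) <= 2.
Proof.
unfold ker_re, Rdiv; rewrite Rabs_mult, (Rabs_pos_eq (/ _))
  by (apply Rlt_le, Rinv_0_lt_compat; nra).
apply Rmult_le_reg_r with (1 + w * w); [nra|].
rewrite Rmult_assoc, Rinv_l by apply one_plus_sqr_neq0.
pose proof (COS_bound (s * w)); pose proof (SIN_bound (s * w)).
rewrite Rmult_1_r; set (c := cos (s * w)) in *; set (d := sin (s * w)) in *.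
assert (c * c <= 1) by nra; assert (d * d <= 1) by nra.
pose proof (Rle_0_sqr (w - d)); pose proof (Rle_0_sqr (w + d)).
pose proof (Rle_0_sqr (w - c)); pose proof (Rle_0_sqr (w + c)); pose proof (Rle_0_sqr w).
unfold Rsqr in *; apply Rabs_le; split; lra.
Qed.

Lemma Rabs_ker_im_le (s w : R) : Rabs (ker_im s w) <= 2.
Proof.
unfold ker_im, Rdiv; rewrite Rabs_mult, (Rabs_pos_eq (/ _))
  by (apply Rlt_le, Rinv_0_lt_compat; nra).
apply Rmult_le_reg_r with (1 + w * w); [nra|].
rewrite Rmult_assoc, Rinv_l by apply one_plus_sqr_neq0.
pose proof (COS_bound (s * w)); pose proof (SIN_bound (s * w)).
rewrite Rmult_1_r; set (c := cos (s * w)) in *; set (d := sin (s * w)) in *.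
assert (c * c <= 1) by nra; assert (d * d <= 1) by nra.
pose proof (Rle_0_sqr (w - d)); pose proof (Rle_0_sqr (w + d)).
pose proof (Rle_0_sqr (w - c)); pose proof (Rle_0_sqr (w + c)); pose proof (Rle_0_sqr w).
unfold Rsqr in *; apply Rabs_le; split; lra.
Qed.

(** Linear growth in [h] is enough: the bound only meets a factor [e^{-S}] with [S] arbitrarily
    large, or serves to show moderateness. *)
Lemma Rabs_int_ker_le (h s : R) : Rabs (int_ker h s) <= 4 * Rabs h.
Proof.
replace (4 * Rabs h) with (Rabs (h - - h) * 2).
  apply Rabs_RInt_le_const_gen; [apply ex_RInt_ker_re | intros; apply Rabs_ker_re_le].
replace (h - - h) with (2 * h) by ring; rewrite Rabs_mult, Rabs_pos_eq; lra.
Qed.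

(** Differentiating [e^{-isw}/(1 - iw)] in [s] brings down [-iw = (1 - iw) - 1], hence gives
    [e^{-isw}] minus the kernel itself; the real part of the first term integrates to
    [2 sin(hs)/s]. *)
Lemma is_derive_int_ker (h s : R) :
  s <> 0 -> is_derive (int_ker h) s (2 * sin (h * s) / s - int_ker h s).
Proof.
intros Hs.
assert (D : forall u w, is_derive (fun z => ker_re z w) u (cos (u * w) - ker_re u w)).
  intros u w; unfold ker_re; auto_derive; [exact I|].
  field; apply one_plus_sqr_neq0.
assert (E : RInt (fun w => Derive (fun u => ker_re u w) s) (- h) h =
  2 * sin (h * s) / s - int_ker h s).
  rewrite (RInt_ext _ (fun w => minus (cos (s * w)) (ker_re s w))).
    2: intros w _; exact (is_derive_unique _ _ _ (D s w)).
  assert (C : is_RInt (fun w => cos (s * w)) (- h) h (2 * sin (h * s) / s)).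
    replace (2 * sin (h * s) / s) with (minus (sin (s * h) / s) (sin (s * - h) / s)).
    apply (is_RInt_derive (fun w => sin (s * w) / s)).
    - intros w _; auto_derive; [exact I | field; exact Hs].
    - intros w _; apply (ex_derive_continuous (fun w => cos (s * w))); auto_derive; exact I.
    - unfold minus, plus, opp; simpl; rewrite Ropp_mult_distr_r_reverse, sin_neg.
      rewrite (Rmult_comm h s); field; exact Hs.
  rewrite (RInt_minus (V := R_CompleteNormedModule)) by (exact (ex_RInt_ker_re _ _ _) || (eexists; exact C)).
  rewrite (is_RInt_unique _ _ _ _ C); reflexivity.
rewrite <- E; apply (is_derive_RInt_param ker_re).
- apply filter_forall; intros u w _; eexists; apply D.
- intros w _; apply continuity_2d_pt_ext with (fun u v => cos (u * v) - ker_re u v).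
    intros u v; symmetry; apply is_derive_unique, D.
  assert (Cm : continuity_2d_pt (fun u v => u * v) s w).
    apply continuity_2d_pt_mult; [apply continuity_2d_pt_id1 | apply continuity_2d_pt_id2].
  assert (Cc : continuity_2d_pt (fun u v => cos (u * v)) s w).
    apply continuity_1d_2d_pt_comp; [apply continuity_cos | exact Cm].
  assert (Cs : continuity_2d_pt (fun u v => sin (u * v)) s w).
    apply continuity_1d_2d_pt_comp; [apply continuity_sin | exact Cm].
  apply continuity_2d_pt_minus; [exact Cc|].
  unfold ker_re, Rdiv; apply continuity_2d_pt_mult.
    apply continuity_2d_pt_plus; [exact Cc|].
    apply continuity_2d_pt_mult; [apply continuity_2d_pt_id2 | exact Cs].
  apply continuity_2d_pt_inv; [|apply one_plus_sqr_neq0].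
  apply continuity_2d_pt_plus; [apply continuity_2d_pt_const|].
  apply continuity_2d_pt_mult; apply continuity_2d_pt_id2.
- apply filter_forall; intros u; apply ex_RInt_ker_re.
Qed.

(* [e^s int_ker h s] has derivative [2 e^s sin(hs)/s] away from 0; the second
   term cancels this oscillation and leaves a derivative of order [1/h]. *)
Definition osc_free (h s : R) : R :=
  exp s * int_ker h s + 2 * exp s * cos (h * s) / (h * s).

Lemma is_derive_osc_free (h s : R) :
  0 < h -> s <> 0 ->
  is_derive (osc_free h) s (2 / h * exp s * cos (h * s) * (/ s - / (s * s))).
Proof.
intros Hh Hs; unfold osc_free.
replace (2 / h * exp s * cos (h * s) * (/ s - / (s * s))) with
  ((exp s * int_ker h s + exp s * (2 * sin (h * s) / s - int_ker h s)) +
   (2 / h * exp s * cos (h * s) * (/ s - / (s * s)) - exp s * (2 * sin (h * s) / s)))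
  by (field; lra).
apply (is_derive_plus (fun t => exp t * int_ker h t)
  (fun t => 2 * exp t * cos (h * t) / (h * t))).
- apply (is_derive_mult exp (int_ker h)).
  + apply is_derive_exp.
  + apply is_derive_int_ker, Hs.
  + intros; apply Rmult_comm.
- auto_derive; [apply Rmult_integral_contrapositive_currified; lra | field; lra].
Qed.

(** The right-hand side is chosen for its elementary antiderivative [s - 2/s], from which the
    majorants of [osc_free] are built. *)
Lemma Rinv_sub_inv_sqr_le (s : R) : s <> 0 -> Rabs (/ s - / (s * s)) <= 1 + 2 * / (s * s).
Proof.
intros Hs; rewrite Rinv_mult; set (u := / s); apply Rabs_le; split; nra.
Qed.

Lemma Rabs_mul4_le (a b c d c' d' : R) :
  0 <= a -> 0 <= b -> Rabs c <= c' -> Rabs d <= d' ->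
  Rabs (a * b * c * d) <= a * b * (c' * d').
Proof.
intros Ha Hb Hc Hd; rewrite !Rabs_mult, (Rabs_pos_eq a), (Rabs_pos_eq b) by assumption.
rewrite Rmult_assoc; apply Rmult_le_compat_l; [nra|].
apply Rmult_le_compat; auto using Rabs_pos.
Qed.

Lemma Rabs_cos_le (t : R) : Rabs (cos t) <= 1.
Proof. apply Rabs_le, COS_bound. Qed.

Lemma exp_neg_le_1 (s : R) : s <= 0 -> exp s <= 1.
Proof.
intros Hs; rewrite <- exp_0; destruct (Req_dec s 0) as [->|]; [lra|].
left; apply exp_increasing; lra.
Qed.

(** On the negative axis [e^t <= 1], so the derivative is dominated by that of [2/h * (e^t - 2/t)].
    Integrating from [-S] to [s] leaves a boundary term of size [e^{-S} h], which vanishes as [S]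
    grows. *)
Lemma Rabs_osc_free_neg_le (h s : R) :
  1 <= h -> s < 0 -> Rabs (osc_free h s) <= 2 / h * (1 - 2 / s).
Proof.
intros Hh Hs.
assert (H2h : 0 < 2 / h) by (apply Rdiv_lt_0_compat; lra).
assert (F : forall S, - S <= s -> 1 <= S ->
  Rabs (osc_free h s) <= 2 / h * (1 - 2 / s) + exp (- S) * (6 * h)).
  intros S HS HS1.
  assert (D : Rabs (osc_free h s - osc_free h (- S)) <=
    2 / h * (exp s - 2 / s) - 2 / h * (exp (- S) - 2 / (- S))).
    apply (Rabs_sub_le_of_derive _ (fun t => 2 / h * (exp t - 2 / t))
      (fun t => 2 / h * exp t * cos (h * t) * (/ t - / (t * t)))
      (fun t => 2 / h * (exp t + 2 * / (t * t)))); [lra| | |].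
    - intros t Ht; apply is_derive_osc_free; lra.
    - intros t Ht; auto_derive; [lra | field; lra].
    - intros t Ht; eapply Rle_trans.
        apply Rabs_mul4_le; [lra | left; apply exp_pos | apply Rabs_cos_le |
          apply Rinv_sub_inv_sqr_le; lra].
      rewrite Rmult_1_l, Rmult_assoc; apply Rmult_le_compat_l; [lra|].
      pose proof (exp_neg_le_1 t ltac:(lra)); pose proof (exp_pos t).
      assert (0 < / (t * t)) by (apply Rinv_0_lt_compat; nra).
      nra.
  (* The factor [6 h] collects [4 h] from the crude bound on [int_ker] and at most [2 <= 2 h] from
     the cosine term, as [h S >= 1]. *)
  assert (B : Rabs (osc_free h (- S)) <= exp (- S) * (6 * h)).
    unfold osc_free; replace (exp (- S) * int_ker h (- S) + 2 * exp (- S) * cos (h * - S) / (h * - S))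
      with (exp (- S) * (int_ker h (- S) + 2 * cos (h * - S) * / (h * - S))) by (unfold Rdiv; ring).
    rewrite Rabs_mult, (Rabs_pos_eq (exp _)) by (left; apply exp_pos).
    apply Rmult_le_compat_l; [left; apply exp_pos|].
    eapply Rle_trans; [apply Rabs_triang|].
    pose proof (Rabs_int_ker_le h (- S)) as Hi; rewrite (Rabs_pos_eq h) in Hi by lra.
    rewrite !Rabs_mult, Rabs_inv, (Rabs_pos_eq 2) by lra.
    pose proof (Rabs_cos_le (h * - S)); pose proof (Rabs_pos (cos (h * - S))).
    assert (/ Rabs (h * - S) <= 1).
      rewrite <- Rinv_1; apply Rinv_le_contravar; [lra|].
      rewrite Rabs_mult, Rabs_Ropp, !Rabs_pos_eq by lra; nra.
    assert (0 <= / Rabs (h * - S)).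
      rewrite <- Rabs_inv; apply Rabs_pos.
    nra.
  assert (2 / (- S) <= 0).
    replace (2 / - S) with (- (2 * / S)) by (field; lra).
    pose proof (Rinv_0_lt_compat S ltac:(lra)); lra.
  pose proof (exp_pos (- S)); pose proof (exp_neg_le_1 s ltac:(lra)).
  replace (osc_free h s) with ((osc_free h s - osc_free h (- S)) + osc_free h (- S)) by ring.
  eapply Rle_trans; [apply Rabs_triang|].
  assert (2 / h * exp s <= 2 / h * 1) by (apply Rmult_le_compat_l; lra).
  assert (0 <= 2 / h * exp (- S)) by nra.
  assert (0 <= 2 / h * - (2 / - S)) by (apply Rmult_le_pos; lra).
  lra.
apply Rle_plus_epsilon; intros eta Heta.
(* Since [e^S >= S], the third entry makes the boundary term at most [eta]. *)
set (S := Rmax (Rmax 1 (- s)) (6 * h / eta)).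
assert (1 <= S) by (eapply Rle_trans; [apply Rmax_l | apply Rmax_l]).
assert (- s <= S) by (eapply Rle_trans; [apply Rmax_r | apply Rmax_l]).
assert (HS : 6 * h / eta <= S) by apply Rmax_r.
eapply Rle_trans; [apply (F S); lra|].
apply Rplus_le_compat_l.
rewrite exp_Ropp; apply Rmult_le_reg_l with (exp S); [apply exp_pos|].
replace (exp S * (/ exp S * (6 * h))) with (6 * h)
  by (field; apply Rgt_not_eq, exp_pos).
pose proof (exp_ineq1_le S).
apply Rle_trans with (S * eta); [|apply Rmult_le_compat_r; lra].
replace (6 * h) with (6 * h / eta * eta) by (field; lra).
apply Rmult_le_compat_r; lra.
Qed.

(** Removing the cosine correction from [osc_free] costs another [(2/h)/|s|], whence 3 in place of
    2. *)
Lemma Rabs_exp_int_ker_neg_le (h s : R) :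
  1 <= h -> s < 0 -> Rabs (exp s * int_ker h s) <= 2 / h * (1 - 3 / s).
Proof.
intros Hh Hs; pose proof (Rabs_osc_free_neg_le h s Hh Hs) as B.
assert (E : exp s * int_ker h s = osc_free h s + - (2 / h * (exp s * cos (h * s)) * / s)).
  unfold osc_free; field; lra.
rewrite E; eapply Rle_trans; [apply Rabs_triang|]; rewrite Rabs_Ropp.
assert (H2h : 0 < 2 / h) by (apply Rdiv_lt_0_compat; lra).
assert (Rabs (2 / h * (exp s * cos (h * s)) * / s) <= 2 / h * - / s).
  rewrite !Rabs_mult, (Rabs_pos_eq (2 / h)), Rabs_inv, (Rabs_left s), Rmult_assoc by lra.
  apply Rmult_le_compat_l; [lra|].
  rewrite (Rabs_pos_eq (exp s)) by (left; apply exp_pos).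
  replace (/ - s) with (- / s) by (field; lra).
  pose proof (exp_pos s); pose proof (exp_neg_le_1 s ltac:(lra)).
  pose proof (Rabs_cos_le (h * s)); pose proof (Rabs_pos (cos (h * s))).
  pose proof (Rinv_lt_0_compat s Hs).
  rewrite <- (Rmult_1_l (- / s)) at 2; apply Rmult_le_compat_r; [lra|]; nra.
replace (2 / h * (1 - 3 / s)) with (2 / h * (1 - 2 / s) + 2 / h * - / s)
  by (field; lra).
lra.
Qed.

(** The exponential is frozen at its maximum [e^p] on [[d, p]], so [e^p (t - 2/t)] gives the
    majorant. It contributes at most [p + 2/d], and the two cosine corrections at most
    [1/p + 1/d <= 2/d]. *)
Lemma Rabs_exp_int_ker_sub_le (h d p : R) :
  1 <= h -> 0 < d -> d <= p ->
  Rabs (exp p * int_ker h p - exp d * int_ker h d) <= exp p * (2 / h * (p + 4 / d)).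
Proof.
intros Hh Hd Hp.
assert (H2h : 0 < 2 / h) by (apply Rdiv_lt_0_compat; lra).
assert (Mono : forall t, t <= p -> exp t <= exp p).
  intros t Ht; destruct (Req_dec t p) as [->|]; [lra|]; left; apply exp_increasing; lra.
assert (D : Rabs (osc_free h p - osc_free h d) <=
  2 / h * (exp p * (p - 2 / p)) - 2 / h * (exp p * (d - 2 / d))).
  apply (Rabs_sub_le_of_derive _ (fun t => 2 / h * (exp p * (t - 2 / t)))
    (fun t => 2 / h * exp t * cos (h * t) * (/ t - / (t * t)))
    (fun t => 2 / h * (exp p * (1 + 2 * / (t * t))))); [lra| | |].
  - intros t Ht; apply is_derive_osc_free; lra.
  - intros t Ht; auto_derive; [lra | field; lra].
  - intros t Ht; eapply Rle_trans.
      apply Rabs_mul4_le; [lra | left; apply exp_pos | apply Rabs_cos_le |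
        apply Rinv_sub_inv_sqr_le; lra].
    rewrite Rmult_1_l, Rmult_assoc; apply Rmult_le_compat_l; [lra|].
    assert (0 < / (t * t)) by (apply Rinv_0_lt_compat; nra).
    apply Rmult_le_compat_r; [lra | apply Mono; lra].
assert (B : forall s, d <= s <= p ->
  Rabs (2 / h * (exp s * cos (h * s)) * / s) <= 2 / h * (exp p * / s)).
  intros s Hs; rewrite !Rabs_mult, (Rabs_pos_eq (2 / h)), Rabs_inv, (Rabs_pos_eq s), Rmult_assoc by lra.
  apply Rmult_le_compat_l; [lra|].
  rewrite (Rabs_pos_eq (exp s)) by (left; apply exp_pos).
  pose proof (exp_pos s); pose proof (Mono s ltac:(lra)).
  pose proof (Rabs_cos_le (h * s)); pose proof (Rabs_pos (cos (h * s))).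
  pose proof (Rinv_0_lt_compat s ltac:(lra)).
  apply Rmult_le_compat_r; [lra|]; nra.
assert (E : exp p * int_ker h p - exp d * int_ker h d =
  (osc_free h p - osc_free h d) +
  (- (2 / h * (exp p * cos (h * p)) * / p) + 2 / h * (exp d * cos (h * d)) * / d)).
  unfold osc_free; field; lra.
rewrite E; eapply Rle_trans; [apply Rabs_triang|].
eapply Rle_trans; [apply Rplus_le_compat_l, Rabs_triang|]; rewrite Rabs_Ropp.
pose proof (B p ltac:(lra)); pose proof (B d ltac:(lra)); pose proof (exp_pos p).
assert (0 < 2 / h * exp p) by nra.
pose proof (Rinv_0_lt_compat p ltac:(lra)); pose proof (Rinv_0_lt_compat d Hd).
assert (/ p <= / d) by (apply Rinv_le_contravar; lra).
set (c := 2 / h * exp p) in *.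
replace (exp p * (2 / h * (p + 4 / d))) with (c * p + c * (4 * / d))
  by (unfold c; field; lra).
replace (2 / h * (exp p * (p - 2 / p)) - 2 / h * (exp p * (d - 2 / d)))
  with (c * (p - d - 2 * / p + 2 * / d)) in D by (unfold c; field; lra).
replace (2 / h * (exp p * / p)) with (c * / p) in * by (unfold c; ring).
replace (2 / h * (exp p * / d)) with (c * / d) in * by (unfold c; ring).
nra.
Qed.

(** In the sum the terms [w sin(sw)] cancel and [2 cos(sw)/(1 + w^2)] remains. Comparing with
    [2/(1 + w^2)], whose integral is [4 atan h], and using [1 - cos u <= u^2/2], the integrands
    differ by at most [s^2] on an interval of length [2h]. *)
Lemma int_ker_even_part (h s : R) :
  0 < h -> Rabs (int_ker h s + int_ker h (- s) - 4 * atan h) <= 2 * h * (s * s).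
Proof.
intros Hh.
assert (A : is_RInt (fun w => / (1 + w * w)) (- h) h (2 * atan h)).
  replace (2 * atan h) with (minus (atan h) (atan (- h))).
  apply (is_RInt_derive atan).
  - intros w _; pose proof (is_derive_atan w) as Dw; unfold Rsqr in Dw; exact Dw.
  - intros w _; apply (ex_derive_continuous (fun w => / (1 + w * w))); auto_derive.
    apply one_plus_sqr_neq0.
  - unfold minus, plus, opp; simpl; rewrite atan_opp; ring.
pose proof (is_RInt_plus _ _ _ _ _ _ (RInt_correct _ _ _ (ex_RInt_ker_re s (- h) h))
  (RInt_correct _ _ _ (ex_RInt_ker_re (- s) (- h) h))) as P.
pose proof (is_RInt_minus _ _ _ _ _ _ P (is_RInt_scal _ _ _ 2 _ A)) as Q.
apply (is_RInt_unique (V := R_CompleteNormedModule)) in Q.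
match type of Q with ?L = _ =>
  replace (int_ker h s + int_ker h (- s) - 4 * atan h) with L
    by (etransitivity; [exact Q|];
        unfold minus, plus, opp, scal, int_ker; simpl; unfold mult; simpl; ring)
end.
replace (2 * h * (s * s)) with ((h - - h) * (s * s)) by ring.
apply abs_RInt_le_const; [lra | eexists; eapply is_RInt_minus; [exact P | apply is_RInt_scal, A]|].
intros w _; unfold minus, plus, opp, scal; simpl; unfold mult; simpl; unfold ker_re.
rewrite Ropp_mult_distr_l_reverse, cos_neg, sin_neg.
replace (_ + _) with (- (2 * (1 - cos (s * w)) / (1 + w * w)))
  by (field; apply one_plus_sqr_neq0).
assert (Hc : 1 - cos (s * w) = 2 * (sin (s * w / 2) * sin (s * w / 2))).
  replace (s * w) with (2 * (s * w / 2)) at 1 by field; rewrite cos_2a_sin; ring.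
assert (Hs : sin (s * w / 2) * sin (s * w / 2) <= s * w / 2 * (s * w / 2)).
  assert (L : forall t, 0 <= t -> sin t * sin t <= t * t).
    intros t Ht; destruct (Req_dec t 0) as [->|Hn]; [rewrite sin_0; lra|].
    destruct (Rle_dec 1 t).
      pose proof (SIN_bound t); nra.
    pose proof (sin_lt_x t ltac:(lra)).
    assert (0 <= sin t) by (apply sin_ge_0; [lra|]; pose proof PI2_1; lra).
    nra.
  destruct (Rle_dec 0 (s * w / 2)) as [Hp|Hn]; [apply L, Hp|].
  pose proof (L (- (s * w / 2)) ltac:(lra)) as L'; rewrite sin_neg in L'; lra.
rewrite Rabs_Ropp, Rabs_pos_eq.
- apply Rmult_le_reg_r with (1 + w * w); [nra|].
  unfold Rdiv at 1; rewrite Rmult_assoc, Rinv_l by apply one_plus_sqr_neq0.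
  nra.
- apply Rmult_le_pos; [pose proof (COS_bound (s * w)); lra|].
  apply Rlt_le, Rinv_0_lt_compat; nra.
Qed.

(** With [d = 1/(hr)], the conditions on [h r p] and [h r q] say that [d <= p] and [d <= q], and the
    last one says that [p/h <= r]. The constant is [10 + 8 + 182]: moving from [p] to [d],
    discarding the value at [-q], and evaluating at [d]; all are bounded with [e^p >= 1]. *)
Lemma Rabs_int_ker_diff_le (h r p q : R) :
  0 < r <= 1 -> 1 <= h * r ^ 3 -> 1 <= h * r * p -> 1 <= h * r * q -> p <= h * r ->
  Rabs (exp p * int_ker h p - exp (- q) * int_ker h (- q) - 2 * PI) <= 200 * r * exp p.
Proof.
intros [Hr0 Hr1] H3 Hp Hq Hph.
assert (Hr2 : r * r <= r) by nra.
assert (Hr3 : r ^ 3 <= r) by (simpl; rewrite Rmult_1_r; nra).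
assert (Hh : 1 <= h).
  destruct (Rle_dec 1 h); [lra|exfalso].
  assert (0 < r ^ 3) by (apply pow_lt; lra); nra.
assert (Hhr : 1 <= h * r) by nra.
assert (Hhrr : 1 <= h * r * r * r) by (simpl in H3; lra).
set (d := / (h * r)).
assert (Hd0 : 0 < d) by (apply Rinv_0_lt_compat; lra).
assert (Hdr : h * r * d = 1) by (unfold d; field; lra).
assert (Hdle : forall u, 1 <= h * r * u -> d <= u).
  intros u Hu; apply Rmult_le_reg_l with (h * r); lra.
pose proof (Hdle p Hp) as Hdp; pose proof (Hdle q Hq) as Hdq.
assert (Hd1 : d <= r) by (apply Hdle; nra).
assert (Hh' : / h <= r).
  apply Rmult_le_reg_l with h; [lra|]; rewrite Rinv_r; lra.
assert (Hh0 : 0 < / h) by (apply Rinv_0_lt_compat; lra).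
assert (Hhd : / h * / d = r) by (unfold d; field; lra).
assert (Neg : forall s, d <= s -> Rabs (exp (- s) * int_ker h (- s)) <= 8 * r).
  intros s Hs; eapply Rle_trans; [apply Rabs_exp_int_ker_neg_le; lra|].
  assert (/ s <= / d) by (apply Rinv_le_contravar; lra).
  assert (/ h * / s <= / h * / d) by (apply Rmult_le_compat_l; lra).
  replace (2 / h * (1 - 3 / - s)) with (2 * / h + 6 * (/ h * / s)) by (field; lra).
  lra.
assert (Pos : Rabs (exp p * int_ker h p - exp d * int_ker h d) <= exp p * (10 * r)).
  eapply Rle_trans; [apply Rabs_exp_int_ker_sub_le; lra|].
  apply Rmult_le_compat_l; [left; apply exp_pos|].
  replace (2 / h * (p + 4 / d)) with (2 * (p * / h) + 8 * (/ h * / d)) by (field; lra).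
  assert (p * / h <= r).
    apply Rmult_le_reg_r with h; [lra|]; rewrite Rmult_assoc, Rinv_l by lra; lra.
  lra.
(* From [e^{-d} >= 1 - d] one gets [e^d <= 1 + d e^d], and [e^d <= 3] because [d <= r <= 1]. *)
assert (Ed : exp d <= 1 + 3 * d).
  assert (H := exp_ineq1_le (- d)); rewrite exp_Ropp in H.
  assert (Hx : exp d * (1 + - d) <= 1).
    rewrite <- (Rinv_r (exp d)) at 2 by (apply Rgt_not_eq, exp_pos).
    apply Rmult_le_compat_l; [left; apply exp_pos | lra].
  assert (exp d <= 3).
    eapply Rle_trans; [|apply exp_le_3].
    destruct (Req_dec d 1) as [->|]; [lra|]; left; apply exp_increasing; lra.
  nra.
assert (1 <= exp p) by (pose proof (exp_ineq1_le p); lra).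
assert (E1 : 1 <= exp d) by (pose proof (exp_ineq1_le d); lra).
assert (Id : Rabs (int_ker h (- d)) <= 32 * r).
  replace (int_ker h (- d)) with (exp d * (exp (- d) * int_ker h (- d))).
    rewrite Rabs_mult, (Rabs_pos_eq (exp d)) by lra.
    pose proof (Neg d ltac:(lra)); pose proof (Rabs_pos (exp (- d) * int_ker h (- d))).
    apply Rle_trans with (4 * (8 * r)); [|lra]; apply Rmult_le_compat; lra.
  rewrite exp_Ropp; field; apply Rgt_not_eq, exp_pos.
assert (Ev : Rabs (int_ker h d + int_ker h (- d) - 2 * PI) <= 6 * r).
  pose proof (int_ker_even_part h d ltac:(lra)) as Ev.
  assert (2 * h * (d * d) <= 2 * r).
    assert (h * (d * d) <= r); [|lra].
    apply Rmult_le_reg_l with (h * r * r); [nra|].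
    replace (h * r * r * (h * (d * d))) with ((h * r * d) * (h * r * d)) by ring.
    rewrite Hdr; lra.
  assert (At : Rabs (2 * PI - 4 * atan h) <= 4 * r).
    replace (2 * PI - 4 * atan h) with (4 * atan (/ h)) by (rewrite atan_inv by lra; lra).
    assert (0 <= atan (/ h)).
      rewrite <- atan_0; left; apply atan_increasing; lra.
    assert (atan (/ h) <= / h).
      pose proof (Rabs_sub_le_of_derive atan (fun t => t) (fun t => / (1 + t * t))
        (fun _ => 1) 0 (/ h) ltac:(lra)) as M.
      rewrite atan_0, !Rminus_0_r in M.
      eapply Rle_trans; [apply Rle_abs|]; apply M.
      - intros t _; pose proof (is_derive_atan t) as Dt; unfold Rsqr in Dt; exact Dt.
      - intros t _; apply (is_derive_id t).
      - intros t _; rewrite Rabs_inv, Rabs_pos_eq by nra.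
        rewrite <- Rinv_1; apply Rinv_le_contravar; nra.
    rewrite Rabs_pos_eq; lra.
  replace (int_ker h d + int_ker h (- d) - 2 * PI) with
    ((int_ker h d + int_ker h (- d) - 4 * atan h) - (2 * PI - 4 * atan h)) by ring.
  eapply Rle_trans; [apply Rabs_triang|]; rewrite Rabs_Ropp; lra.
(* [int_ker h d] is recovered from the even part by subtracting [int_ker h (- d)], which is small by
   the estimate on the negative axis. *)
assert (Jd : Rabs (exp d * int_ker h d - 2 * PI) <= 182 * r).
  replace (exp d * int_ker h d - 2 * PI) with
    (exp d * ((int_ker h d + int_ker h (- d) - 2 * PI) - int_ker h (- d)) + (exp d - 1) * (2 * PI))
    by ring.
  eapply Rle_trans; [apply Rabs_triang|].
  rewrite (Rabs_mult (exp d)), (Rabs_mult (exp d - 1)).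
  rewrite (Rabs_pos_eq (exp d)), (Rabs_pos_eq (exp d - 1)), (Rabs_pos_eq (2 * PI))
    by (pose proof PI_RGT_0; lra).
  assert (B : Rabs (int_ker h d + int_ker h (- d) - 2 * PI - int_ker h (- d)) <= 38 * r).
    eapply Rle_trans; [apply Rabs_triang|]; rewrite Rabs_Ropp; lra.
  pose proof (Rabs_pos (int_ker h d + int_ker h (- d) - 2 * PI - int_ker h (- d))).
  pose proof PI_4; pose proof PI_RGT_0.
  assert (exp d * Rabs (int_ker h d + int_ker h (- d) - 2 * PI - int_ker h (- d)) <= 4 * (38 * r))
    by (apply Rmult_le_compat; lra).
  assert ((exp d - 1) * (2 * PI) <= (3 * r) * (2 * 4)) by (apply Rmult_le_compat; lra).
  lra.
replace (exp p * int_ker h p - exp (- q) * int_ker h (- q) - 2 * PI) with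
  ((exp p * int_ker h p - exp d * int_ker h d) +
   (- (exp (- q) * int_ker h (- q)) + (exp d * int_ker h d - 2 * PI))) by ring.
pose proof (Neg q Hdq).
eapply Rle_trans; [apply Rabs_triang|].
eapply Rle_trans; [apply Rplus_le_compat_l, Rabs_triang|]; rewrite Rabs_Ropp.
nra.
Qed.

(** * Nets and their classes *)

Lemma small_conj (P Q : R -> Prop) :
  small P -> small Q -> small (fun e => P e /\ Q e).
Proof. intros HP HQ; apply (small_and _ _ _ HP HQ); auto. Qed.

Lemma gauge_pow_le (rho : gauge) (n m : nat) (e : R) :
  0 < e <= 1 -> (n <= m)%nat -> rho e ^ m <= rho e ^ n.
Proof.
intros He Hnm; replace m with (n + (m - n))%nat by lia; rewrite pow_add.
pose proof (gauge_pow rho n e He); pose proof (gauge_pow rho (m - n) e He); nra.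
Qed.

Lemma gauge_pow_half (rho : gauge) (n : nat) (e : R) :
  0 < e <= 1 -> rho e <= 1 / 2 -> 2 * rho e ^ S n <= rho e ^ n.
Proof. intros He Hr; pose proof (gauge_pow rho n e He); simpl; nra. Qed.

Lemma gauge_half (rho : gauge) : small (fun e => rho e <= 1 / 2).
Proof. apply gauge_small; lra. Qed.

Lemma moderate_sub (rho : gauge) (x y : R -> R) :
  moderate rho x -> moderate rho y -> moderate rho (fun e => x e - y e).
Proof. intros Hx Hy; apply moderate_add; auto using moderate_opp. Qed.

Lemma moderate_gauge_pow (rho : gauge) (n : nat) : moderate rho (fun e => rho e ^ n).
Proof.
apply (moderate_le _ _ _ (moderate_const rho 1)); intros e He.
pose proof (gauge_pow rho n e He); rewrite !Rabs_pos_eq; lra.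
Qed.

Lemma moderate_inv_gauge_pow (rho : gauge) (n : nat) : moderate rho (fun e => / rho e ^ n).
Proof.
exists n; exists 1; split; [lra|]; intros e He.
rewrite Rabs_pos_eq; [lra|]; apply Rlt_le, Rinv_0_lt_compat, gauge_pow, He.
Qed.

Create HintDb moderate.
#[local] Hint Resolve moderate_const moderate_add moderate_sub moderate_opp moderate_mul
  moderate_abs moderate_neg_log moderate_rho moderate_gauge_pow moderate_inv_gauge_pow
  repr_moderate : moderate.

Lemma equivalent_of_small_eq (rho : gauge) (x y : R -> R) :
  small (fun e => x e = y e) -> equivalent rho x y.
Proof.
intros H m; apply (small_imp _ _ H); intros e He ->.
rewrite Rminus_diag, Rabs_R0; left; apply gauge_pow, He.
Qed.

Lemma equivalent_of_le (rho : gauge) (x y x' y' : R -> R) :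
  equivalent rho x y ->
  (forall e, 0 < e <= 1 -> Rabs (x' e - y' e) <= Rabs (x e - y e)) ->
  equivalent rho x' y'.
Proof.
intros H Hle; apply (equivalent_dom rho _ _ _ _ (fun _ => 1) (moderate_const rho 1) H).
intros e He; rewrite Rabs_R1, Rmult_1_l; auto.
Qed.

Lemma equivalent_mul_l (rho : gauge) (c x y : R -> R) :
  moderate rho c -> equivalent rho x y ->
  equivalent rho (fun e => c e * x e) (fun e => c e * y e).
Proof.
intros Hc H; apply (equivalent_dom _ _ _ _ _ _ Hc H); intros e _.
rewrite <- Rmult_minus_distr_l, Rabs_mult; lra.
Qed.

(** The order requires the inequality at every [e]; the minimum with [y] enforces it and alters [x]
    only where it fails, so not for small [e]. *)
Lemma cls_le_of_small (rho : gauge) (x y : R -> R) :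
  moderate rho x -> moderate rho y -> small (fun e => x e <= y e) ->
  (cls rho x <= cls rho y)%Rt.
Proof.
intros Hx Hy H; exists (fun e => Rmin (x e) (y e)), y.
assert (E : equivalent rho x (fun e => Rmin (x e) (y e))).
  apply equivalent_of_small_eq, (small_imp _ _ H); intros e _ Hle.
  rewrite Rmin_left; auto.
pose proof (moderate_equivalent _ _ _ Hx E) as M.
repeat split; auto; [apply cls_eq; auto | intros; apply Rmin_r].
Qed.

(** Ordered representatives exist, but the given ones are merely equivalent to them; hence the slack
    [rho^m], with [m] at choice. *)
Lemma small_le_of_cls (rho : gauge) (x y : R -> R) :
  moderate rho x -> moderate rho y -> (cls rho x <= cls rho y)%Rt ->
  forall m, small (fun e => x e <= y e + rho e ^ m).
Proof.
intros Hx Hy (x' & y' & Hx' & Hy' & Ex & Ey & L) m.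
apply cls_eq in Ex; trivial; apply cls_eq in Ey; trivial.
apply (small_imp _ _ (small_conj _ _ (small_conj _ _ (Ex (S m)) (Ey (S m))) (gauge_half rho))).
intros e He [[H1 H2] H3]; pose proof (gauge_pow_half rho m e He H3); specialize (L e He).
pose proof (Rle_abs (x e - x' e)); pose proof (Rle_abs (- (y e - y' e))).
rewrite Rabs_Ropp in *; lra.
Qed.

(** If [x y] is within 1/2 of 1 and [|y| <= rho^{-N}], then [|x| >= rho^N / 2], and one more power
    of [rho] absorbs the factor 1/2. *)
Lemma small_ge_of_invertible (rho : gauge) (x : R -> R) :
  moderate rho x -> Rt_invertible (cls rho x) ->
  exists N : nat, small (fun e => rho e ^ N <= Rabs (x e)).
Proof.
intros Hx [Y HY]; rewrite <- (cls_repr rho Y), cls_mul in HY by auto with moderate.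
apply cls_eq in HY; [|auto with moderate..].
destruct (repr_moderate rho Y) as [N HN]; exists (S N).
apply (small_imp _ _ (small_conj _ _ (small_conj _ _ (HY 1%nat) HN) (gauge_half rho))).
intros e He [[H1 H2] H3]; pose proof (gauge_pow_half rho N e He H3).
pose proof (gauge_pow rho N e He) as HNp.
set (u := rho e ^ N) in *; set (y := repr Y e) in *; rewrite pow_1 in H1.
assert (Hxy : 1 / 2 <= Rabs (x e) * Rabs y).
  rewrite <- Rabs_mult; pose proof (Rle_abs (- (x e * y - 1))) as Ha.
  rewrite Rabs_Ropp in Ha; pose proof (Rle_abs (x e * y)); lra.
pose proof (Rabs_pos (x e)).
assert (1 / 2 <= Rabs (x e) * / u).
  eapply Rle_trans; [exact Hxy|]; apply Rmult_le_compat_l; lra.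
assert (1 / 2 * u <= Rabs (x e)); [|lra].
replace (Rabs (x e)) with (Rabs (x e) * / u * u) by (field; lra).
apply Rmult_le_compat_r; lra.
Qed.

Lemma invertible_of_small_ge (rho : gauge) (x : R -> R) (N : nat) :
  moderate rho x -> small (fun e => rho e ^ N <= Rabs (x e)) ->
  Rt_invertible (cls rho x).
Proof.
intros Hx H.
(* Cutting off to 0 where the lower bound fails keeps [|z| <= rho^{-N}] on all of (0,1], as
   [moderate_le] asks. *)
set (z := fun e => if Rle_dec (rho e ^ N) (Rabs (x e)) then / x e else 0).
assert (Hz : moderate rho z).
  apply (moderate_le _ _ _ (moderate_inv_gauge_pow rho N)); intros e He.
  pose proof (gauge_pow rho N e He).
  pose proof (Rinv_0_lt_compat (rho e ^ N) ltac:(lra)).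
  rewrite (Rabs_pos_eq (/ _)) by lra; unfold z; destruct Rle_dec as [Hle|].
  - rewrite Rabs_inv; apply Rinv_le_contravar; lra.
  - rewrite Rabs_R0; lra.
exists (cls rho z); rewrite cls_mul by assumption.
apply cls_eq; auto with moderate.
apply equivalent_of_small_eq, (small_imp _ _ H); intros e He Hle.
pose proof (gauge_pow rho N e He).
unfold z; destruct Rle_dec; [|contradiction]; apply Rinv_r.
intros E; rewrite E, Rabs_R0 in Hle; lra.
Qed.

Lemma cls_sub (rho : gauge) (x y : R -> R) :
  moderate rho x -> moderate rho y ->
  (cls rho x - cls rho y)%Rt = cls rho (fun e => x e - y e).
Proof.
intros Hx Hy; unfold Rt_sub; rewrite cls_opp, cls_add by auto with moderate; reflexivity.
Qed.

(** The radius of a ball exceeds the distance from [x] to its center by an invertible amount, hence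
    by some [rho^N]. So the nets [x + rho^{N+1}] and [x - rho^{N+1}] still lie in the ball, and
    therefore in the interval. *)
Lemma sharp_interior_itv (rho : gauge) (a b x : R -> R) :
  moderate rho a -> moderate rho b -> moderate rho x ->
  sharp_interior (Rt_itv (cls rho a) (cls rho b)) (cls rho x) ->
  exists N : nat, small (fun e => a e + rho e ^ N <= x e /\ x e + rho e ^ N <= b e).
Proof.
intros Ha Hb Hx (U & HU & UK & Ux).
destruct (HU _ Ux) as (c & r & _ & Hxc & Hball).
revert Hxc Hball; rewrite <- (cls_repr rho c), <- (cls_repr rho r).
assert (Mc := repr_moderate rho c); assert (Mr := repr_moderate rho r).
revert Mc Mr; generalize (repr c) as cn, (repr r) as rn; clear c r.
intros c r Mc Mr; unfold sharp_ball.
rewrite cls_sub, cls_abs by auto with moderate; intros [Hle Hinv] Hball.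
rewrite cls_sub in Hinv by auto with moderate.
apply small_ge_of_invertible in Hinv; [|auto with moderate].
destruct Hinv as [N HN].
apply small_le_of_cls with (m := S N) in Hle; [rename Hle into Hd | auto with moderate..].
assert (Hz : forall z : R -> R, moderate rho z ->
    (forall e, 0 < e <= 1 -> Rabs (z e - x e) <= rho e ^ S N) ->
    Rt_itv (cls rho a) (cls rho b) (cls rho z)).
  intros z Mz Hzx; apply UK, Hball.
  rewrite cls_sub, cls_abs by auto with moderate.
  assert (G : small (fun e => rho e ^ S N <= r e - Rabs (z e - c e))).
    apply (small_imp _ _ (small_conj _ _ (small_conj _ _ HN Hd) (gauge_half rho))).
    intros e He [[H1 H2] H3]; pose proof (gauge_pow_half rho N e He H3).
    pose proof (gauge_pow rho N e He).
    (* The order alone only gives [r - |x - c| >= - rho^{N+1}]; a negative value would be at most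
       [- rho^N] by invertibility, a contradiction. *)
    assert (0 <= r e - Rabs (x e - c e)).
      apply Rnot_lt_le; intros Hn; rewrite Rabs_left in H1 by exact Hn; lra.
    rewrite Rabs_pos_eq in H1 by assumption.
    pose proof (Rabs_triang (z e - x e) (x e - c e)) as T.
    replace (z e - x e + (x e - c e)) with (z e - c e) in T by ring.
    specialize (Hzx e He); lra.
  split.
  - apply cls_le_of_small; auto with moderate.
    apply (small_imp _ _ G); intros e He H; pose proof (gauge_pow rho (S N) e He); lra.
  - rewrite cls_sub by auto with moderate.
    apply invertible_of_small_ge with (S N); auto with moderate.
    apply (small_imp _ _ G); intros e He H; pose proof (Rle_abs (r e - Rabs (z e - c e))); lra.
(* Reading the class inequalities back on representatives costs a slack [rho^{N+2}], at most half of
   the margin [rho^{N+1}]. *)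
exists (S (S N)).
destruct (Hz (fun e => x e + rho e ^ S N)) as [_ Hp].
  auto with moderate.
  intros e He; replace (_ - _) with (rho e ^ S N) by ring.
  rewrite Rabs_pos_eq; [lra | apply Rlt_le, gauge_pow, He].
destruct (Hz (fun e => x e - rho e ^ S N)) as [Hm _].
  auto with moderate.
  intros e He; replace (_ - _) with (- rho e ^ S N) by ring.
  rewrite Rabs_Ropp, Rabs_pos_eq; [lra | apply Rlt_le, gauge_pow, He].
apply small_le_of_cls with (m := S (S N)) in Hp; [|auto with moderate..].
apply small_le_of_cls with (m := S (S N)) in Hm; [|auto with moderate..].
apply (small_imp _ _ (small_conj _ _ (small_conj _ _ Hp Hm) (gauge_half rho))).
intros e He [[H1 H2] H3]; pose proof (gauge_pow_half rho (S N) e He H3); lra.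
Qed.

(* Selecting a worst point for each [e] turns pointwise statements about nets
   into statements uniform on the interval. *)
Lemma small_forall_itv (P : R -> R -> Prop) (a b : R -> R) :
  (forall t : R -> R, (forall e, Rmin (a e) (b e) <= t e <= Rmax (a e) (b e)) ->
    small (fun e => P e (t e))) ->
  small (fun e => forall s, Rmin (a e) (b e) <= s <= Rmax (a e) (b e) -> P e s).
Proof.
intros H.
assert (W : forall e, exists s, Rmin (a e) (b e) <= s <= Rmax (a e) (b e) /\
    (P e s -> forall s', Rmin (a e) (b e) <= s' <= Rmax (a e) (b e) -> P e s')).
  intros e.
  destruct (classic (exists s, Rmin (a e) (b e) <= s <= Rmax (a e) (b e) /\ ~ P e s))
    as [(s & Hs & Hn)|Hn].
  - exists s; split; [exact Hs | contradiction].
  - exists (a e); split; [split; [apply Rmin_l | apply Rmax_l]|].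
    intros _ s' Hs'; apply NNPP; intros Hc; apply Hn; exists s'; auto.
set (t := fun e => proj1_sig (constructive_indefinite_description _ (W e))).
assert (Ht : forall e, Rmin (a e) (b e) <= t e <= Rmax (a e) (b e) /\
    (P e (t e) -> forall s', Rmin (a e) (b e) <= s' <= Rmax (a e) (b e) -> P e s')).
  intros e; exact (proj2_sig (constructive_indefinite_description _ (W e))).
apply (small_imp _ _ (H t (fun e => proj1 (Ht e)))).
intros e _; apply (proj2 (Ht e)).
Qed.

Lemma moderate_between (rho : gauge) (a b t : R -> R) :
  moderate rho a -> moderate rho b ->
  (forall e, Rmin (a e) (b e) <= t e <= Rmax (a e) (b e)) -> moderate rho t.
Proof.
intros Ha Hb Ht.
apply (moderate_le _ _ (fun e => Rabs (a e) + Rabs (b e))); [auto with moderate|].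
intros e _; rewrite (Rabs_pos_eq (_ + _)) by (apply Rplus_le_le_0_compat; apply Rabs_pos).
specialize (Ht e); revert Ht.
unfold Rmin, Rmax; destruct Rle_dec; intros; apply Rabs_le;
  pose proof (Rle_abs (a e)); pose proof (Rle_abs (b e));
  pose proof (Rle_abs (- a e)); pose proof (Rle_abs (- b e));
  pose proof (Rabs_pos (a e)); pose proof (Rabs_pos (b e));
  rewrite !Rabs_Ropp in *; lra.
Qed.

Lemma cls_between_in_itv (rho : gauge) (a b t : R -> R) :
  moderate rho a -> moderate rho b -> small (fun e => a e <= b e) ->
  (forall e, Rmin (a e) (b e) <= t e <= Rmax (a e) (b e)) ->
  Rt_itv (cls rho a) (cls rho b) (cls rho t).
Proof.
intros Ha Hb Hab Ht; pose proof (moderate_between rho a b t Ha Hb Ht).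
split; apply cls_le_of_small; trivial; apply (small_imp _ _ Hab); intros e _ Hle;
  specialize (Ht e); rewrite Rmin_left, Rmax_right in Ht by exact Hle; lra.
Qed.

(** * Smooth real nets and the equation y' = y *)

Definition smooth_net (rho : gauge) (X : Rt rho -> Prop) (f : R -> R -> R) : Prop :=
  (forall e, 0 < e <= 1 -> forall j t, ex_derive_n (f e) j t) /\
  (forall x, moderate rho x -> X (cls rho x) ->
     forall j, moderate rho (fun e => Derive_n (f e) j (x e))).

Lemma moderate_Re_of_Cmod (rho : gauge) (z : R -> C) :
  moderate rho (fun e => Cmod (z e)) -> moderate rho (fun e => Re (z e)).
Proof.
intros H; apply (moderate_le _ _ _ H); intros e _.
rewrite (Rabs_pos_eq (Cmod _)) by apply Cmod_ge_0.
eapply Rle_trans; [apply Rmax_l | apply Rmax_Cmod].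
Qed.

Lemma moderate_Im_of_Cmod (rho : gauge) (z : R -> C) :
  moderate rho (fun e => Cmod (z e)) -> moderate rho (fun e => Im (z e)).
Proof.
intros H; apply (moderate_le _ _ _ H); intros e _.
rewrite (Rabs_pos_eq (Cmod _)) by apply Cmod_ge_0.
eapply Rle_trans; [apply Rmax_r | apply Rmax_Cmod].
Qed.

Lemma defines_smooth_net_Re (rho : gauge) (X : Rt rho -> Prop) fe f :
  defines X fe f -> smooth_net rho X (fun e s => Re (fe e s)).
Proof.
intros [Hs Hd]; split.
- intros e He j t; apply (Hs e He j t).
- intros x Hx HX j; exact (moderate_Re_of_Cmod _ _ (proj2 (Hd x Hx HX) j)).
Qed.

Lemma defines_smooth_net_Im (rho : gauge) (X : Rt rho -> Prop) fe f :
  defines X fe f -> smooth_net rho X (fun e s => Im (fe e s)).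
Proof.
intros [Hs Hd]; split.
- intros e He j t; apply (Hs e He j t).
- intros x Hx HX j; exact (moderate_Im_of_Cmod _ _ (proj2 (Hd x Hx HX) j)).
Qed.

(** By the mean value theorem the difference is governed by the next derivative at an intermediate
    point [c]. As [c] is squeezed between equivalent nets it represents the same class, so
    moderateness at points of [X] suffices, whatever the shape of [X]. This frees [GSF_derive] from
    its chosen representative. *)
Lemma smooth_net_equivalent (rho : gauge) (X : Rt rho -> Prop) f j (x x' : R -> R) :
  smooth_net rho X f -> moderate rho x -> moderate rho x' -> equivalent rho x x' ->
  X (cls rho x) ->
  equivalent rho (fun e => Derive_n (f e) j (x e)) (fun e => Derive_n (f e) j (x' e)).
Proof.
intros [Hs Hm] Hx Hx' E HX.
assert (W : forall e, exists c, 0 < e <= 1 ->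
    Rmin (x e) (x' e) <= c <= Rmax (x e) (x' e) /\
    Derive_n (f e) j (x' e) - Derive_n (f e) j (x e) =
      Derive_n (f e) (S j) c * (x' e - x e)).
  intros e; destruct (classic (0 < e <= 1)) as [He|He]; [|exists 0; tauto].
  destruct (MVT_gen (Derive_n (f e) j) (x e) (x' e) (Derive_n (f e) (S j))) as [c Hc].
  - intros t _; apply Derive_correct, (Hs e He (S j) t).
  - intros t _; apply continuity_pt_filterlim, (ex_derive_continuous (Derive_n (f e) j)).
    apply (Hs e He (S j) t).
  - exists c; intros _; exact Hc.
set (c := fun e => proj1_sig (constructive_indefinite_description _ (W e))).
assert (Hc : forall e, 0 < e <= 1 -> Rmin (x e) (x' e) <= c e <= Rmax (x e) (x' e) /\
    Derive_n (f e) j (x' e) - Derive_n (f e) j (x e) =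
      Derive_n (f e) (S j) (c e) * (x' e - x e)).
  intros e; exact (proj2_sig (constructive_indefinite_description _ (W e))).
assert (Ec : equivalent rho x c).
  apply (equivalent_of_le _ _ _ _ _ E); intros e He.
  destruct (Hc e He) as [H _]; revert H; unfold Rmin, Rmax; destruct Rle_dec; intros.
    rewrite !Rabs_left1; lra.
  rewrite !Rabs_pos_eq; lra.
assert (Mc := moderate_equivalent _ _ _ Hx Ec).
assert (Xc : X (cls rho c)) by (rewrite <- (proj2 (cls_eq rho x c Hx Mc) Ec); exact HX).
apply (equivalent_dom _ _ _ _ _ _ (Hm c Mc Xc (S j)) E).
intros e He; destruct (Hc e He) as [_ H].
rewrite Rabs_minus_sym, H, Rabs_mult, (Rabs_minus_sym (x' e)); lra.
Qed.

(** The function [e^{-r} u(r)] has derivative [e^{-r} (u' - u)], bounded by [e^{-a} eta];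
    multiplying its increment by [e^t <= e^b] gives the factor [e^{b-a}]. *)
Lemma exp_ode_approx (u : R -> R) (a b eta : R) :
  (forall t, a <= t <= b -> ex_derive u t) ->
  (forall t, a <= t <= b -> Rabs (Derive u t - u t) <= eta) ->
  forall s t, a <= s <= b -> a <= t <= b ->
  Rabs (u t - exp (t - s) * u s) <= exp (b - a) * (b - a) * eta.
Proof.
intros Hu He.
assert (M : forall s t, s <= t -> exp s <= exp t).
  intros s t Hst; destruct (Req_dec s t) as [->|]; [lra|]; left; apply exp_increasing; lra.
assert (L : forall s t, a <= s <= b -> a <= t <= b -> s <= t ->
    Rabs (exp (- t) * u t - exp (- s) * u s) <= exp (- a) * eta * (b - a)).
  intros s t Hs Ht Hst.
  assert (0 <= eta) by (eapply Rle_trans; [apply Rabs_pos | apply (He s Hs)]).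
  assert (0 <= exp (- a) * eta) by (apply Rmult_le_pos; [left; apply exp_pos | lra]).
  apply Rle_trans with (exp (- a) * eta * t - exp (- a) * eta * s); [|nra].
  apply (Rabs_sub_le_of_derive (fun r => exp (- r) * u r) (fun r => exp (- a) * eta * r)
    (fun r => exp (- r) * (Derive u r - u r)) (fun _ => exp (- a) * eta)); [exact Hst| | |].
  - intros r Hr; auto_derive; [apply Hu; lra|].
    change (Derive (fun z => u z) r) with (Derive u r); ring.
  - intros r _; auto_derive; [exact I | ring].
  - intros r Hr; rewrite Rabs_mult, Rabs_pos_eq by (left; apply exp_pos).
    apply Rmult_le_compat; [left; apply exp_pos | apply Rabs_pos | apply M; lra | apply He; lra].
intros s t Hs Ht.
replace (u t - exp (t - s) * u s) with (exp t * (exp (- t) * u t - exp (- s) * u s)).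
- rewrite Rabs_mult, (Rabs_pos_eq (exp t)) by (left; apply exp_pos).
  replace (exp (b - a) * (b - a) * eta) with (exp b * (exp (- a) * eta * (b - a)))
    by (replace (exp (b - a)) with (exp b * exp (- a)) by (rewrite <- exp_plus; reflexivity);
        ring).
  apply Rmult_le_compat; [left; apply exp_pos | apply Rabs_pos | apply M; lra|].
  destruct (Rle_dec s t); [apply L; lra|].
  rewrite Rabs_minus_sym; apply L; lra.
- replace (exp (t - s)) with (exp t * exp (- s)) by (rewrite <- exp_plus; reflexivity).
  rewrite (exp_Ropp t); field; apply Rgt_not_eq, exp_pos.
Qed.

(** [small_forall_itv] makes the error in the equation uniform on the interval, below any power of
    [rho]. The loss [e^{b-a} (b-a)] is at most some [rho^{-N}], so the equation is taken with error
    [rho^{N+m}]. *)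
Lemma exp_ode_net (rho : gauge) (X : Rt rho -> Prop) (f : R -> R -> R) (a b : R -> R) :
  moderate rho a -> moderate rho b -> moderate rho (fun e => exp (b e - a e)) ->
  (forall e, 0 < e <= 1 -> a e <= b e) ->
  X = Rt_itv (cls rho a) (cls rho b) ->
  smooth_net rho X f ->
  (forall t, moderate rho t -> X (cls rho t) ->
    equivalent rho (fun e => Derive_n (f e) 1 (t e)) (fun e => f e (t e))) ->
  forall s t : R -> R,
  small (fun e => a e <= s e <= b e) -> small (fun e => a e <= t e <= b e) ->
  equivalent rho (fun e => f e (t e)) (fun e => exp (t e - s e) * f e (s e)).
Proof.
intros Ha Hb Hexp Hab -> Hf Hode s t Hs Ht.
assert (Hba : moderate rho (fun e => exp (b e - a e) * (b e - a e))) by auto with moderate.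
destruct Hba as [N HN]; intros m.
assert (U : small (fun e => forall r, Rmin (a e) (b e) <= r <= Rmax (a e) (b e) ->
    Rabs (Derive_n (f e) 1 r - f e r) <= rho e ^ (N + m))).
  apply small_forall_itv; intros r Hr; apply Hode.
    exact (moderate_between _ _ _ _ Ha Hb Hr).
  apply cls_between_in_itv; trivial.
  exists 1; split; [lra | exact Hab].
apply (small_imp _ _ (small_conj _ _ (small_conj _ _ U HN) (small_conj _ _ Hs Ht))).
intros e He [[H1 H2] [H3 H4]].
specialize (Hab e He); rewrite Rmin_left, Rmax_right in H1 by exact Hab.
eapply Rle_trans; [apply (exp_ode_approx (f e) (a e) (b e) (rho e ^ (N + m))); trivial|].
  intros r _; exact (proj1 Hf e He 1%nat r).
pose proof (gauge_pow rho N e He); pose proof (gauge_pow rho m e He).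
apply Rle_trans with (/ rho e ^ N * rho e ^ (N + m)).
  apply Rmult_le_compat_r; [left; apply gauge_pow, He|].
  eapply Rle_trans; [apply Rle_abs | exact H2].
rewrite pow_add, <- Rmult_assoc, Rinv_l by lra; lra.
Qed.

(** * Elementary nets *)

(** The class contains the integrand, is closed under differentiation, and takes moderate values at
    moderate points. This yields moderateness of all derivatives at once, without a formula for the
    [j]-th derivative of the kernel. *)
Inductive elem_net (rho : gauge) : (R -> R -> R) -> Prop :=
| elem_const c : moderate rho c -> elem_net rho (fun e _ => c e)
| elem_var : elem_net rho (fun _ t => t)
| elem_cos a : moderate rho a -> elem_net rho (fun e t => cos (a e * t))
| elem_sin a : moderate rho a -> elem_net rho (fun e t => sin (a e * t))
| elem_inv : elem_net rho (fun _ t => / (1 + t * t))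
| elem_opp f : elem_net rho f -> elem_net rho (fun e t => - f e t)
| elem_add f g : elem_net rho f -> elem_net rho g -> elem_net rho (fun e t => f e t + g e t)
| elem_mul f g : elem_net rho f -> elem_net rho g -> elem_net rho (fun e t => f e t * g e t).

Lemma elem_net_is_derive (rho : gauge) f :
  elem_net rho f ->
  exists g, elem_net rho g /\ forall e t, is_derive (f e) t (g e t).
Proof.
intros H; induction H as [c Hc| |a Ha|a Ha| |f _ [f' [Hf' Df]]
  |f g _ [f' [Hf' Df]] _ [g' [Hg' Dg]]|f g Hf [f' [Hf' Df]] Hg [g' [Hg' Dg]]].
- exists (fun _ _ => 0); split; [apply (elem_const rho (fun _ => 0)), moderate_const|].
  intros e t; apply (is_derive_const (c e)).
- exists (fun _ _ => 1); split; [apply (elem_const rho (fun _ => 1)), moderate_const|].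
  intros e t; apply (is_derive_id t).
- exists (fun e t => (- a e) * sin (a e * t)); split.
    apply (elem_mul rho (fun e _ => - a e) (fun e t => sin (a e * t))).
      apply (elem_const rho (fun e => - a e)); auto with moderate.
    apply elem_sin, Ha.
  intros e t; auto_derive; [exact I | ring].
- exists (fun e t => a e * cos (a e * t)); split.
    apply (elem_mul rho (fun e _ => a e) (fun e t => cos (a e * t))).
      apply elem_const, Ha.
    apply elem_cos, Ha.
  intros e t; auto_derive; [exact I | ring].
- exists (fun e t => (- 2 * t) * (/ (1 + t * t) * / (1 + t * t))); split.
    apply (elem_mul rho (fun e t => - 2 * t) (fun e t => / (1 + t * t) * / (1 + t * t))).
      apply (elem_mul rho (fun _ _ => - 2) (fun _ t => t));
        [apply (elem_const rho (fun _ => - 2)), moderate_const | apply elem_var].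
    apply (elem_mul rho (fun _ t => / (1 + t * t))); apply elem_inv.
  intros e t; auto_derive; [apply one_plus_sqr_neq0 | field; apply one_plus_sqr_neq0].
- exists (fun e t => - f' e t); split; [apply elem_opp, Hf'|].
  intros e t; apply (is_derive_opp (f e)), Df.
- exists (fun e t => f' e t + g' e t); split; [apply elem_add; assumption|].
  intros e t; apply (is_derive_plus (f e) (g e)); auto.
- exists (fun e t => f' e t * g e t + f e t * g' e t); split.
    apply (elem_add rho (fun e t => f' e t * g e t) (fun e t => f e t * g' e t));
      apply elem_mul; assumption.
  intros e t; apply (is_derive_mult (f e) (g e)); auto; intros; apply Rmult_comm.
Qed.

Lemma elem_net_Derive_n (rho : gauge) f j :
  elem_net rho f ->
  exists g, elem_net rho g /\
    forall e t, ex_derive_n (f e) j t /\ Derive_n (f e) j t = g e t.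
Proof.
intros Hf; induction j as [|j [g [Hg Eg]]].
  exists f; split; [exact Hf|]; intros; split; [exact I | reflexivity].
destruct (elem_net_is_derive rho g Hg) as [h [Hh Dg]].
exists h; split; [exact Hh|]; intros e t.
assert (D : is_derive (Derive_n (f e) j) t (h e t)).
  apply (is_derive_ext (g e)); [intros r; symmetry; apply Eg | apply Dg].
split; [exists (h e t); exact D | apply is_derive_unique, D].
Qed.

Lemma elem_net_moderate (rho : gauge) f t :
  elem_net rho f -> moderate rho t -> moderate rho (fun e => f e (t e)).
Proof.
intros Hf Ht; induction Hf; auto with moderate.
- apply (moderate_le _ _ _ (moderate_const rho 1)); intros e _.
  rewrite Rabs_R1; apply Rabs_cos_le.
- apply (moderate_le _ _ _ (moderate_const rho 1)); intros e _.
  rewrite Rabs_R1; apply Rabs_le, SIN_bound.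
- apply (moderate_le _ _ _ (moderate_const rho 1)); intros e _.
  rewrite Rabs_R1, Rabs_inv, Rabs_pos_eq by nra.
  rewrite <- Rinv_1; apply Rinv_le_contravar; nra.
Qed.

Lemma defines_of_elem_net (rho : gauge) (X : Rt rho -> Prop) (fe : R -> R -> C) f :
  elem_net rho (fun e t => Re (fe e t)) -> elem_net rho (fun e t => Im (fe e t)) ->
  (forall x, moderate rho x -> X (cls rho x) ->
    f (cls rho x) = ccls rho (fun e => fe e (x e))) ->
  defines X fe f.
Proof.
intros Hr Hi Hf; split.
- intros e _ j t.
  destruct (elem_net_Derive_n rho _ j Hr) as [g [_ Eg]].
  destruct (elem_net_Derive_n rho _ j Hi) as [h [_ Eh]].
  split; [apply (Eg e t) | apply (Eh e t)].
- intros x Hx HX; split; [apply Hf; assumption|]; intros j.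
  destruct (elem_net_Derive_n rho _ j Hr) as [g [Hg Eg]].
  destruct (elem_net_Derive_n rho _ j Hi) as [h [Hh Eh]].
  apply moderate_Cmod; unfold Cderive_n; simpl.
  + apply (moderate_le _ _ _ (elem_net_moderate rho g x Hg Hx)); intros e _.
    rewrite <- (proj2 (Eg e (x e))); apply Rle_refl.
  + apply (moderate_le _ _ _ (elem_net_moderate rho h x Hh Hx)); intros e _.
    rewrite <- (proj2 (Eh e (x e))); apply Rle_refl.
Qed.

(** * Complex nets and the integrand of the inverse transform *)

Definition cmoderate (rho : gauge) (z : R -> C) : Prop :=
  moderate rho (fun e => Re (z e)) /\ moderate rho (fun e => Im (z e)).

Lemma cmoderate_mul (rho : gauge) (u v : R -> C) :
  cmoderate rho u -> cmoderate rho v -> cmoderate rho (fun e => (u e * v e)%C).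
Proof.
intros [] []; split; unfold Re, Im in *; simpl; auto with moderate.
Qed.

Lemma cmoderate_sub (rho : gauge) (u v : R -> C) :
  cmoderate rho u -> cmoderate rho v -> cmoderate rho (fun e => (u e - v e)%C).
Proof.
intros [] []; split; unfold Re, Im in *; simpl; auto with moderate.
Qed.

Lemma cmoderate_RtoC (rho : gauge) (c : R -> R) :
  moderate rho c -> cmoderate rho (fun e => RtoC (c e)).
Proof. intros Hc; split; simpl; auto with moderate. Qed.

Lemma cmoderate_expi (rho : gauge) (t : R -> R) :
  cmoderate rho (fun e => (cos (t e), sin (t e))).
Proof.
split; simpl; apply (moderate_le _ _ _ (moderate_const rho 1)); intros e _; rewrite Rabs_R1.
  apply Rabs_cos_le.
apply Rabs_le, SIN_bound.
Qed.

Lemma ccls_eq (rho : gauge) (u v : R -> C) :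
  cmoderate rho u ->
  equivalent rho (fun e => Re (u e)) (fun e => Re (v e)) ->
  equivalent rho (fun e => Im (u e)) (fun e => Im (v e)) ->
  ccls rho u = ccls rho v.
Proof.
intros [H1 H2] E1 E2; unfold ccls; f_equal; apply cls_eq; trivial.
  exact (moderate_equivalent _ _ _ H1 E1).
exact (moderate_equivalent _ _ _ H2 E2).
Qed.

Lemma ccls_inj (rho : gauge) (u v : R -> C) :
  cmoderate rho u -> cmoderate rho v -> ccls rho u = ccls rho v ->
  equivalent rho (fun e => Re (u e)) (fun e => Re (v e)) /\
  equivalent rho (fun e => Im (u e)) (fun e => Im (v e)).
Proof.
intros [] [] E; injection E; intros E2 E1; split; apply cls_eq; assumption.
Qed.

Lemma ccls_mul (rho : gauge) (u v : R -> C) :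
  cmoderate rho u -> cmoderate rho v ->
  (ccls rho u * ccls rho v)%Ct = ccls rho (fun e => (u e * v e)%C).
Proof.
intros [] []; unfold Ct_mul, ccls, Re, Im in *; simpl.
rewrite !cls_mul, cls_sub, cls_add by auto with moderate; reflexivity.
Qed.

Lemma ccls_sub (rho : gauge) (u v : R -> C) :
  cmoderate rho u -> cmoderate rho v ->
  (ccls rho u - ccls rho v)%Ct = ccls rho (fun e => (u e - v e)%C).
Proof.
intros [] []; unfold Ct_sub, Ct_add, Ct_opp, ccls, Re, Im in *; simpl.
rewrite !cls_opp, !cls_add by auto with moderate; reflexivity.
Qed.

Lemma ccls_crepr (rho : gauge) (u : Ct rho) : ccls rho (crepr u) = u.
Proof.
destruct u as [a b]; unfold ccls, crepr; simpl.
f_equal; [exact (cls_repr rho a) | exact (cls_repr rho b)].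
Qed.

Lemma cmoderate_crepr (rho : gauge) (u : Ct rho) : cmoderate rho (crepr u).
Proof. split; [exact (repr_moderate rho (fst u)) | exact (repr_moderate rho (snd u))]. Qed.

(** [Ct_inv] is only some chosen inverse, so it is identified through uniqueness of inverses in a
    commutative ring. *)
Lemma ccls_inv (rho : gauge) (u v : R -> C) :
  cmoderate rho u -> cmoderate rho v -> (forall e, (u e * v e)%C = RtoC 1) ->
  Ct_inv (ccls rho u) = ccls rho v.
Proof.
intros Hu Hv E.
assert (E1 : (ccls rho u * ccls rho v)%Ct = Ct_of_Rt 1%Rt).
  rewrite ccls_mul by assumption.
  rewrite (functional_extensionality _ _ E); reflexivity.
assert (E2 : (ccls rho u * Ct_inv (ccls rho u))%Ct = Ct_of_Rt 1%Rt).
  unfold Ct_inv; apply epsilon_spec; exists (ccls rho v); exact E1.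
assert (One : forall w : Ct rho, Ct_mul w (Ct_of_Rt 1%Rt) = w).
  intros w; rewrite <- (ccls_crepr rho w); pose proof (cmoderate_crepr rho w).
  change (Ct_of_Rt 1%Rt) with (ccls rho (fun _ => RtoC 1)).
  rewrite ccls_mul by (trivial; apply (cmoderate_RtoC rho (fun _ => 1)), moderate_const).
  f_equal; apply functional_extensionality; intros e; ring.
(* This one rearrangement combines the commutativity and associativity needed for
   [u^{-1} = u^{-1} (u v) = v (u u^{-1}) = v]. *)
assert (Swap : forall a b c : Ct rho, (a * (b * c))%Ct = (c * (b * a))%Ct).
  intros a b c.
  rewrite <- (ccls_crepr rho a), <- (ccls_crepr rho b), <- (ccls_crepr rho c).
  pose proof (cmoderate_crepr rho a); pose proof (cmoderate_crepr rho b).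
  pose proof (cmoderate_crepr rho c).
  rewrite !ccls_mul by auto using cmoderate_mul.
  f_equal; apply functional_extensionality; intros e; ring.
rewrite <- (One (Ct_inv _)), <- E1, Swap, E2, One; reflexivity.
Qed.

Definition ker (s w : R) : C := (ker_re s w, ker_im s w).

Lemma elem_net_ker_re (rho : gauge) (s : R -> R) :
  moderate rho s -> elem_net rho (fun e w => ker_re (s e) w).
Proof.
intros Hs; apply (elem_mul rho (fun e w => cos (s e * w) + w * sin (s e * w))
  (fun _ w => / (1 + w * w))); [|apply elem_inv].
apply (elem_add rho (fun e w => cos (s e * w))); [apply elem_cos, Hs|].
apply (elem_mul rho (fun _ w => w)); [apply elem_var | apply elem_sin, Hs].
Qed.

Lemma elem_net_ker_im (rho : gauge) (s : R -> R) :
  moderate rho s -> elem_net rho (fun e w => ker_im (s e) w).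
Proof.
intros Hs; apply (elem_mul rho (fun e w => w * cos (s e * w) - sin (s e * w))
  (fun _ w => / (1 + w * w))); [|apply elem_inv].
apply (elem_add rho (fun e w => w * cos (s e * w)) (fun e w => - sin (s e * w))).
  apply (elem_mul rho (fun _ w => w)); [apply elem_var | apply elem_cos, Hs].
apply (elem_opp rho (fun e w => sin (s e * w))), elem_sin, Hs.
Qed.

(* The net [Y e^{-ipw}/(1 - iw) - Z e^{-iqw}/(1 - iw)], with boundary values
   [Y], [Z]; below [p = k - x] and [q = - k - x]. *)
Definition bd_net (Y Z : R -> C) (p q : R -> R) (e w : R) : C :=
  (Y e * ker (p e) w - Z e * ker (q e) w)%C.

Lemma elem_net_bd_Re (rho : gauge) Y Z p q :
  cmoderate rho Y -> cmoderate rho Z -> moderate rho p -> moderate rho q ->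
  elem_net rho (fun e w => Re (bd_net Y Z p q e w)).
Proof.
intros [HY HY'] [HZ HZ'] Hp Hq.
assert (M : forall (c s : R -> R), moderate rho c -> moderate rho s ->
    elem_net rho (fun e w => c e * ker_re (s e) w) /\
    elem_net rho (fun e w => c e * ker_im (s e) w)).
  intros c s Hc Hs; split; apply (elem_mul rho (fun e _ => c e));
    auto using elem_const, elem_net_ker_re, elem_net_ker_im.
assert (S : forall (c d s : R -> R), moderate rho c -> moderate rho d -> moderate rho s ->
    elem_net rho (fun e w => c e * ker_re (s e) w - d e * ker_im (s e) w)).
  intros c d s Hc Hd Hs; apply elem_add; [apply M; assumption|].
  apply (elem_opp rho (fun e w => d e * ker_im (s e) w)), M; assumption.
apply (elem_add rho
  (fun e w => Re (Y e) * ker_re (p e) w - Im (Y e) * ker_im (p e) w)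
  (fun e w => - (Re (Z e) * ker_re (q e) w - Im (Z e) * ker_im (q e) w))).
  apply (S (fun e => Re (Y e)) (fun e => Im (Y e))); assumption.
apply (elem_opp rho (fun e w => Re (Z e) * ker_re (q e) w - Im (Z e) * ker_im (q e) w)).
apply (S (fun e => Re (Z e)) (fun e => Im (Z e))); assumption.
Qed.

Lemma elem_net_bd_Im (rho : gauge) Y Z p q :
  cmoderate rho Y -> cmoderate rho Z -> moderate rho p -> moderate rho q ->
  elem_net rho (fun e w => Im (bd_net Y Z p q e w)).
Proof.
intros [HY HY'] [HZ HZ'] Hp Hq.
assert (S : forall (c d s : R -> R), moderate rho c -> moderate rho d -> moderate rho s ->
    elem_net rho (fun e w => c e * ker_im (s e) w + d e * ker_re (s e) w)).
  intros c d s Hc Hd Hs; apply elem_add.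
    apply (elem_mul rho (fun e _ => c e)); auto using elem_const, elem_net_ker_im.
  apply (elem_mul rho (fun e _ => d e)); auto using elem_const, elem_net_ker_re.
apply (elem_add rho
  (fun e w => Re (Y e) * ker_im (p e) w + Im (Y e) * ker_re (p e) w)
  (fun e w => - (Re (Z e) * ker_im (q e) w + Im (Z e) * ker_re (q e) w))).
  apply (S (fun e => Re (Y e)) (fun e => Im (Y e))); assumption.
apply (elem_opp rho (fun e w => Re (Z e) * ker_im (q e) w + Im (Z e) * ker_re (q e) w)).
apply (S (fun e => Re (Z e)) (fun e => Im (Z e))); assumption.
Qed.

Lemma integrand_eq_bd_net (rho : gauge) (y : Rt rho -> Ct rho) (Y Z : R -> C) (k x w : R -> R) :
  cmoderate rho Y -> cmoderate rho Z -> moderate rho k -> moderate rho x -> moderate rho w ->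
  y (cls rho k) = ccls rho Y -> y (- cls rho k)%Rt = ccls rho Z ->
  (Delta_bd (cls rho k) y (cls rho w) / (Ct_of_Rt 1%Rt - Ct_i rho * Ct_of_Rt (cls rho w))
    * Ct_expi (cls rho x * cls rho w)%Rt)%Ct =
  ccls rho (fun e => bd_net Y Z (fun e => k e - x e) (fun e => - k e - x e) e (w e)).
Proof.
intros HY HZ Hk Hx Hw EY EZ; unfold Delta_bd, Ct_div.
rewrite EY, EZ, !cls_mul, cls_opp, !cls_expi by auto with moderate.
change (Ct_of_Rt 1%Rt) with (ccls rho (fun _ => RtoC 1)).
change (Ct_i rho) with (ccls rho (fun _ => Ci)).
change (Ct_of_Rt (cls rho w)) with (ccls rho (fun e => RtoC (w e))).
assert (M1 : cmoderate rho (fun _ => RtoC 1))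
  by (apply (cmoderate_RtoC rho (fun _ => 1)), moderate_const).
assert (Mi : cmoderate rho (fun _ => Ci)) by (split; simpl; apply moderate_const).
pose proof (cmoderate_RtoC rho w Hw) as Mw.
pose proof (cmoderate_expi rho (fun e => - (k e * w e))) as Me1.
pose proof (cmoderate_expi rho (fun e => k e * w e)) as Me2.
pose proof (cmoderate_expi rho (fun e => x e * w e)) as Me3.
assert (Minv : cmoderate rho (fun e => (1 / (1 + w e * w e), w e / (1 + w e * w e)))).
  pose proof (elem_net_moderate rho _ w (elem_inv rho) Hw) as Hi.
  split; simpl; [apply (moderate_mul rho (fun _ => 1)) | apply (moderate_mul rho w)];
    auto with moderate.
rewrite (ccls_mul rho (fun _ => Ci)), (ccls_sub rho (fun _ => RtoC 1))
  by auto using cmoderate_mul.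
(* The inverse of [1 - iw] is written as [(1 + iw)/(1 + w^2)]. *)
rewrite (ccls_inv rho _ (fun e => ((1 / (1 + w e * w e), w e / (1 + w e * w e)) : C))).
- rewrite (ccls_mul rho Y), (ccls_mul rho Z), ccls_sub by auto using cmoderate_mul.
  rewrite ccls_mul, ccls_mul by auto using cmoderate_mul, cmoderate_sub.
  f_equal; apply functional_extensionality; intros e.
  pose proof (one_plus_sqr_neq0 (w e)).
  unfold bd_net, ker, ker_re, ker_im.
  replace ((k e - x e) * w e) with (k e * w e - x e * w e) by ring.
  replace ((- k e - x e) * w e) with (- (k e * w e + x e * w e)) by ring.
  rewrite !cos_neg, !sin_neg, cos_minus, sin_minus, cos_plus, sin_plus.
  apply injective_projections; simpl; field; assumption.
- auto using cmoderate_mul, cmoderate_sub.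
- exact Minv.
- intros e; pose proof (one_plus_sqr_neq0 (w e)).
  apply injective_projections; simpl; field; assumption.
Qed.

(** * Integrals of nets *)

Lemma ex_RInt_of_ex_derive (f : R -> R) (a b : R) :
  (forall t, ex_derive f t) -> ex_RInt f a b.
Proof.
intros H; apply (ex_RInt_continuous f); intros t _; apply (ex_derive_continuous f), H.
Qed.

(** [small_forall_itv] turns closeness along every net of points into uniform closeness [rho^{N+m}],
    and the length of the interval is at most [rho^{-N}]. *)
Lemma RInt_net_equivalent (rho : gauge) (f g : R -> R -> R) (a b : R -> R) :
  moderate rho a -> moderate rho b ->
  (forall e, 0 < e <= 1 -> forall t, ex_derive (f e) t) ->
  (forall e, 0 < e <= 1 -> forall t, ex_derive (g e) t) ->
  (forall t : R -> R, (forall e, Rmin (a e) (b e) <= t e <= Rmax (a e) (b e)) ->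
    equivalent rho (fun e => f e (t e)) (fun e => g e (t e))) ->
  equivalent rho (fun e => RInt (f e) (a e) (b e)) (fun e => RInt (g e) (a e) (b e)).
Proof.
intros Ha Hb Hf Hg H.
assert (Hba : moderate rho (fun e => b e - a e)) by auto with moderate.
destruct Hba as [N HN]; intros m.
assert (U := small_forall_itv (fun e s => Rabs (f e s - g e s) <= rho e ^ (N + m)) a b
  (fun t Ht => H t Ht (N + m)%nat)); cbv beta in U.
apply (small_imp _ _ (small_conj _ _ U HN)); intros e He [H1 H2].
pose proof (ex_RInt_of_ex_derive _ (a e) (b e) (Hf e He)) as If.
pose proof (ex_RInt_of_ex_derive _ (a e) (b e) (Hg e He)) as Ig.
pose proof (RInt_minus (V := R_CompleteNormedModule) _ _ _ _ If Ig) as E.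
change (RInt (fun t => f e t - g e t) (a e) (b e) =
  RInt (f e) (a e) (b e) - RInt (g e) (a e) (b e)) in E.
rewrite <- E; eapply Rle_trans.
  apply (Rabs_RInt_le_const_gen _ _ _ (rho e ^ (N + m))); [|exact H1].
  exact (ex_RInt_minus (V := R_NormedModule) _ _ _ _ If Ig).
pose proof (gauge_pow rho N e He); pose proof (gauge_pow rho m e He).
apply Rle_trans with (/ rho e ^ N * rho e ^ (N + m)).
  apply Rmult_le_compat_r; [left; apply gauge_pow, He | exact H2].
rewrite pow_add, <- Rmult_assoc, Rinv_l by lra; lra.
Qed.

Lemma RInt_C (f : R -> C) (a b : R) :
  ex_RInt (fun t => Re (f t)) a b -> ex_RInt (fun t => Im (f t)) a b ->
  RInt (V := C_R_CompleteNormedModule) f a b =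
  (RInt (fun t => Re (f t)) a b, RInt (fun t => Im (f t)) a b).
Proof.
intros Hr Hi; apply (is_RInt_unique (V := C_R_CompleteNormedModule)).
apply (is_RInt_fct_extend_pair (U := R_NormedModule) (V := R_NormedModule)).
  exact (RInt_correct _ _ _ Hr).
exact (RInt_correct _ _ _ Hi).
Qed.

(** The integral is taken over a chosen defining net; this allows it to be computed with any
    explicit one. The eventual order of the representatives ensures that points between them belong
    to the generalized interval, where the two nets agree. Moderateness is required because [cls]
    sends other nets to 0. *)
Lemma GSF_int_eq (rho : gauge) (A B : Rt rho) (f : Rt rho -> Ct rho) (F : R -> R -> C) :
  small (fun e => repr A e <= repr B e) ->
  defines (Rt_itv A B) F f ->
  cmoderate rho (fun e => (RInt (fun t => Re (F e t)) (repr A e) (repr B e),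
                           RInt (fun t => Im (F e t)) (repr A e) (repr B e))) ->
  GSF_int f A B = ccls rho (fun e => (RInt (fun t => Re (F e t)) (repr A e) (repr B e),
                                      RInt (fun t => Im (F e t)) (repr A e) (repr B e))).
Proof.
intros Hab HF HM; unfold GSF_int; set (G := defining_net (Rt_itv A B) f).
assert (HG : defines (Rt_itv A B) G f).
  unfold G, defining_net; apply epsilon_spec; exists F; exact HF.
pose proof (repr_moderate rho A) as Ma; pose proof (repr_moderate rho B) as Mb.
pose proof (defines_smooth_net_Re _ _ _ _ HF) as Fr.
pose proof (defines_smooth_net_Im _ _ _ _ HF) as Fi.
pose proof (defines_smooth_net_Re _ _ _ _ HG) as Gr.
pose proof (defines_smooth_net_Im _ _ _ _ HG) as Gi.
assert (E : forall t : R -> R,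
    (forall e, Rmin (repr A e) (repr B e) <= t e <= Rmax (repr A e) (repr B e)) ->
    equivalent rho (fun e => Re (F e (t e))) (fun e => Re (G e (t e))) /\
    equivalent rho (fun e => Im (F e (t e))) (fun e => Im (G e (t e)))).
  intros t Ht; pose proof (moderate_between _ _ _ _ Ma Mb Ht) as Mt.
  pose proof (cls_between_in_itv _ _ _ _ Ma Mb Hab Ht) as It; rewrite !cls_repr in It.
  apply ccls_inj.
  - split; [apply (proj2 Fr t Mt It 0%nat) | apply (proj2 Fi t Mt It 0%nat)].
  - split; [apply (proj2 Gr t Mt It 0%nat) | apply (proj2 Gi t Mt It 0%nat)].
  - rewrite <- (proj1 (proj2 HF t Mt It)), <- (proj1 (proj2 HG t Mt It)); reflexivity.
assert (Er := RInt_net_equivalent rho (fun e t => Re (F e t)) (fun e t => Re (G e t)) _ _ Ma Mb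
  (fun e He => proj1 Fr e He 1%nat) (fun e He => proj1 Gr e He 1%nat)
  (fun t Ht => proj1 (E t Ht))).
assert (Ei := RInt_net_equivalent rho (fun e t => Im (F e t)) (fun e t => Im (G e t)) _ _ Ma Mb
  (fun e He => proj1 Fi e He 1%nat) (fun e He => proj1 Gi e He 1%nat)
  (fun t Ht => proj2 (E t Ht))).
symmetry; apply ccls_eq; [exact HM| |]; cbv beta.
- apply equivalent_trans with (1 := Er); apply equivalent_of_small_eq.
  exists 1; split; [lra|]; intros e He; rewrite RInt_C; [reflexivity|..];
    apply ex_RInt_of_ex_derive; [exact (proj1 Gr e He 1%nat) | exact (proj1 Gi e He 1%nat)].
- apply equivalent_trans with (1 := Ei); apply equivalent_of_small_eq.
  exists 1; split; [lra|]; intros e He; rewrite RInt_C; [reflexivity|..];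
    apply ex_RInt_of_ex_derive; [exact (proj1 Gr e He 1%nat) | exact (proj1 Gi e He 1%nat)].
Qed.

(** * The inversion formula *)

Lemma moderate_int_ker (rho : gauge) (h s : R -> R) :
  moderate rho h -> moderate rho (fun e => int_ker (h e) (s e)).
Proof.
intros Hh; apply (moderate_le _ _ (fun e => 4 * Rabs (h e))).
  apply (moderate_mul rho (fun _ => 4)); auto with moderate.
intros e _; rewrite (Rabs_pos_eq (4 * _)) by (pose proof (Rabs_pos (h e)); lra).
apply Rabs_int_ker_le.
Qed.

Lemma RInt_ker_comb (h p q c1 c2 c3 c4 : R) :
  RInt (fun w => (c1 * ker_re p w - c2 * ker_im p w) - (c3 * ker_re q w - c4 * ker_im q w))
    (- h) h = c1 * int_ker h p - c3 * int_ker h q.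
Proof.
apply (is_RInt_unique (V := R_CompleteNormedModule)).
assert (L : forall c d s, is_RInt (fun w => c * ker_re s w - d * ker_im s w) (- h) h
    (c * int_ker h s)).
  intros c d s.
  replace (c * int_ker h s) with (c * int_ker h s - d * RInt (ker_im s) (- h) h)
    by (rewrite RInt_ker_im; ring).
  apply (is_RInt_minus (V := R_NormedModule) (fun w => c * ker_re s w) (fun w => d * ker_im s w)).
    apply (is_RInt_scal (V := R_NormedModule) (ker_re s)), (RInt_correct (ker_re s)), ex_RInt_ker_re.
  apply (is_RInt_scal (V := R_NormedModule) (ker_im s)), (RInt_correct (ker_im s)), ex_RInt_ker_im.
apply (is_RInt_minus (V := R_NormedModule) (fun w => c1 * ker_re p w - c2 * ker_im p w)
  (fun w => c3 * ker_re q w - c4 * ker_im q w)); apply L.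
Qed.

(** Needed because the lower limit of the transform is a representative of [- h], only equivalent to
    the negative of that of [h], whereas the cancellation of the odd part requires an exactly
    symmetric interval. *)
Lemma RInt_bounds_equivalent (rho : gauge) (f : R -> R -> R) (a a' b B : R -> R) :
  moderate rho B -> equivalent rho a a' ->
  (forall e, 0 < e <= 1 -> forall t, ex_derive (f e) t) ->
  (forall e, 0 < e <= 1 -> forall t, Rabs (f e t) <= B e) ->
  equivalent rho (fun e => RInt (f e) (a e) (b e)) (fun e => RInt (f e) (a' e) (b e)).
Proof.
intros HB Ha Hf Hbd; apply (equivalent_dom _ _ _ _ _ _ HB Ha); intros e He.
pose proof (fun u v => ex_RInt_of_ex_derive _ u v (Hf e He)) as If.
pose proof (RInt_Chasles (V := R_CompleteNormedModule) (f e) (a e) (a' e) (b e)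
  (If _ _) (If _ _)) as E.
change (RInt (f e) (a e) (a' e) + RInt (f e) (a' e) (b e) = RInt (f e) (a e) (b e)) in E.
rewrite <- E.
assert (S : forall u v : R, u + v - v = u) by (intros; ring); rewrite S.
rewrite Rabs_minus_sym, Rmult_comm.
apply Rabs_RInt_le_const_gen; [apply If|]; intros t _.
eapply Rle_trans; [apply Hbd, He | apply Rle_abs].
Qed.

Lemma Rabs_ker_comb_le (c1 c2 c3 c4 p q w : R) :
  Rabs ((c1 * ker_re p w - c2 * ker_im p w) - (c3 * ker_re q w - c4 * ker_im q w)) <=
  2 * (Rabs c1 + Rabs c2 + Rabs c3 + Rabs c4).
Proof.
pose proof (Rabs_ker_re_le p w); pose proof (Rabs_ker_im_le p w).
pose proof (Rabs_ker_re_le q w); pose proof (Rabs_ker_im_le q w).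
assert (L : forall c u, Rabs u <= 2 -> - (2 * Rabs c) <= c * u <= 2 * Rabs c).
  intros c u Hu; apply Rabs_le_between; rewrite Rabs_mult.
  pose proof (Rabs_pos c); nra.
pose proof (L c1 (ker_re p w) ltac:(assumption)); pose proof (L c2 (ker_im p w) ltac:(assumption)).
pose proof (L c3 (ker_re q w) ltac:(assumption)); pose proof (L c4 (ker_im q w) ltac:(assumption)).
apply Rabs_le; lra.
Qed.

(** Since [int_ker] is real, the real and imaginary parts of the boundary values separate, and the
    asymptotics reduce to the same estimate on real nets, applied twice. *)
Lemma inv_Fourier_bd (rho : gauge) (y : Rt rho -> Ct rho) (Y Z : R -> C) (k x : R -> R)
    (H : Rt rho) :
  cmoderate rho Y -> cmoderate rho Z -> moderate rho k -> moderate rho x ->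
  y (cls rho k) = ccls rho Y -> y (- cls rho k)%Rt = ccls rho Z ->
  small (fun e => 1 <= repr H e) ->
  let p := fun e => k e - x e in let q := fun e => - k e - x e in
  inv_Fourier H (fun w => Delta_bd (cls rho k) y w
      / (Ct_of_Rt 1%Rt - Ct_i rho * Ct_of_Rt w))%Ct (cls rho x) =
  ccls rho (fun e =>
    (1 / (2 * PI) * (Re (Y e) * int_ker (repr H e) (p e) - Re (Z e) * int_ker (repr H e) (q e)),
     1 / (2 * PI) * (Im (Y e) * int_ker (repr H e) (p e) - Im (Z e) * int_ker (repr H e) (q e)))).
Proof.
intros HY HZ Hk Hx EY EZ HH p q.
assert (Mp : moderate rho p) by (unfold p; auto with moderate).
assert (Mq : moderate rho q) by (unfold q; auto with moderate).
set (F := bd_net Y Z p q).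
pose proof (repr_moderate rho H) as Mh.
assert (Ea : equivalent rho (repr (- H)%Rt) (fun e => - repr H e)).
  rewrite <- (cls_repr rho H) at 1; rewrite cls_opp by exact Mh.
  apply repr_cls; auto with moderate.
pose proof (elem_net_bd_Re rho Y Z p q HY HZ Mp Mq) as Er.
pose proof (elem_net_bd_Im rho Y Z p q HY HZ Mp Mq) as Ei.
assert (Dr : forall e t, ex_derive (fun t => Re (F e t)) t).
  destruct (elem_net_is_derive rho _ Er) as [g [_ Dg]]; intros e t; eexists; apply (Dg e t).
assert (Di : forall e t, ex_derive (fun t => Im (F e t)) t).
  destruct (elem_net_is_derive rho _ Ei) as [g [_ Dg]]; intros e t; eexists; apply (Dg e t).
destruct HY as [MY MY'], HZ as [MZ MZ'].
set (B := fun e => 2 * (Rabs (Re (Y e)) + Rabs (Im (Y e)) + Rabs (Re (Z e)) + Rabs (Im (Z e)))).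
assert (MB : moderate rho B).
  unfold B; apply (moderate_mul rho (fun _ => 2)); auto 6 with moderate.
assert (Fr : forall e w, Re (F e w) = (Re (Y e) * ker_re (p e) w - Im (Y e) * ker_im (p e) w)
    - (Re (Z e) * ker_re (q e) w - Im (Z e) * ker_im (q e) w)).
  intros e w; reflexivity.
(* The double signs put the imaginary part in the shape of [RInt_ker_comb] and
   [Rabs_ker_comb_le]. *)
assert (Fi : forall e w, Im (F e w) = (Im (Y e) * ker_re (p e) w - - Re (Y e) * ker_im (p e) w)
    - (Im (Z e) * ker_re (q e) w - - Re (Z e) * ker_im (q e) w)).
  intros e w; unfold F, bd_net, ker, Re, Im; simpl; ring.
assert (Ir : equivalent rho (fun e => RInt (fun t => Re (F e t)) (repr (- H)%Rt e) (repr H e))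
    (fun e => Re (Y e) * int_ker (repr H e) (p e) - Re (Z e) * int_ker (repr H e) (q e))).
  eapply equivalent_trans.
    apply (RInt_bounds_equivalent rho (fun e t => Re (F e t)) _ _ (repr H) B MB Ea);
      [intros; apply Dr|].
    intros e _ t; rewrite Fr; apply Rabs_ker_comb_le.
  apply equivalent_of_small_eq; exists 1; split; [lra|]; intros e _.
  rewrite <- RInt_ker_comb with (c2 := Im (Y e)) (c4 := Im (Z e)).
  apply RInt_ext; intros w _; apply Fr.
assert (Ii : equivalent rho (fun e => RInt (fun t => Im (F e t)) (repr (- H)%Rt e) (repr H e))
    (fun e => Im (Y e) * int_ker (repr H e) (p e) - Im (Z e) * int_ker (repr H e) (q e))).
  eapply equivalent_trans.
    apply (RInt_bounds_equivalent rho (fun e t => Im (F e t)) _ _ (repr H) B MB Ea);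
      [intros; apply Di|].
    intros e _ t; rewrite Fi; eapply Rle_trans; [apply Rabs_ker_comb_le|].
    unfold B; rewrite !Rabs_Ropp; lra.
  apply equivalent_of_small_eq; exists 1; split; [lra|]; intros e _.
  rewrite <- RInt_ker_comb with (c2 := - Re (Y e)) (c4 := - Re (Z e)).
  apply RInt_ext; intros w _; apply Fi.
pose proof (moderate_int_ker rho (repr H) p Mh) as MIp.
pose proof (moderate_int_ker rho (repr H) q Mh) as MIq.
assert (M : cmoderate rho (fun e => (RInt (fun t => Re (F e t)) (repr (- H)%Rt e) (repr H e),
                         RInt (fun t => Im (F e t)) (repr (- H)%Rt e) (repr H e)))).
  split; simpl.
    apply (fun M => moderate_equivalent _ _ _ M (equivalent_sym _ _ _ Ir)); auto with moderate.
  apply (fun M => moderate_equivalent _ _ _ M (equivalent_sym _ _ _ Ii)); auto with moderate.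
unfold inv_Fourier; rewrite (GSF_int_eq rho _ _ _ F); [| | |exact M].
- assert (Mc : cmoderate rho (fun _ => RtoC (1 / (2 * PI))))
    by (apply (cmoderate_RtoC rho (fun _ => _)), moderate_const).
  change (Ct_of_Rt (Rt_const rho (1 / (2 * PI)))) with
    (ccls rho (fun _ => RtoC (1 / (2 * PI)))).
  rewrite ccls_mul by assumption.
  apply ccls_eq; [apply cmoderate_mul; assumption| |]; unfold Re at 1, Im at 1; simpl.
  + eapply equivalent_trans; [|apply (equivalent_mul_l rho (fun _ => 1 / (2 * PI)) _ _
      (moderate_const _ _) Ir)].
    apply equivalent_of_small_eq; exists 1; split; [lra|]; intros e _; simpl; ring.
  + eapply equivalent_trans; [|apply (equivalent_mul_l rho (fun _ => 1 / (2 * PI)) _ _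
      (moderate_const _ _) Ii)].
    apply equivalent_of_small_eq; exists 1; split; [lra|]; intros e _; simpl; ring.
(* Exponent 0 suffices: the lower endpoint is at most [- h + 1], hence at most [h], because
   [h >= 1]. *)
- apply (small_imp _ _ (small_conj _ _ HH (Ea 0%nat))); intros e _ [H1 H2]; simpl in H2.
  pose proof (Rle_abs (repr (- H)%Rt e - - repr H e)); lra.
- apply defines_of_elem_net; [exact Er | exact Ei|]; intros w Hw _.
  apply integrand_eq_bd_net; trivial; split; assumption.
Qed.

(* [int_ker h (k - x)] and [int_ker h (- k - x)] tend to [2 pi e^{-(k-x)}] and [0]. *)
Lemma inversion_net (rho : gauge) (x v Y Z : R -> R) (N n : nat) :
  let k := fun e => - ln (rho e) in
  moderate rho x -> moderate rho v ->
  small (fun e => - k e + rho e ^ N <= x e /\ x e + rho e ^ N <= k e) ->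
  equivalent rho Y (fun e => exp (k e - x e) * v e) ->
  equivalent rho Z (fun e => exp (- k e - x e) * v e) ->
  exists M : nat, forall h : R -> R, moderate rho h ->
    small (fun e => / rho e ^ M <= h e) ->
    small (fun e => Rabs (1 / (2 * PI) *
      (Y e * int_ker (h e) (k e - x e) - Z e * int_ker (h e) (- k e - x e)) - v e) <= rho e ^ n).
Proof.
intros k Hx [Nv Hv] HN HY HZ.
(* The estimate is used with [r = rho^m]. Its error, multiplied by [|v| <= rho^{-Nv}] and
   [e^{k-x} <= rho^{-2}], is [200 rho^{n+2}]. Among the powers of [rho] that [h] must outweigh, [3m]
   serves [h r^3 >= 1], [m + N] the margins of [x], and [m + 2] the bound
   [k - x <= 2k <= rho^{-2}]. *)
set (m := (Nv + n + 4)%nat); exists (3 * m + N + 2)%nat; intros h Mh Hh.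
pose proof (equivalent_mul_l _ _ _ _ (moderate_int_ker rho h (fun e => k e - x e) Mh) HY) as E1.
pose proof (equivalent_mul_l _ _ _ _ (moderate_int_ker rho h (fun e => - k e - x e) Mh) HZ) as E2.
cbv beta in E1, E2.
(* The two replacements of boundary values cost [rho^{n+2} <= rho^n / 4] each. The bound
   [rho <= 1/20] makes [200 rho^2 <= 1/2], so the rest costs at most [rho^n / 2]. *)
apply (small_imp _ _ (small_conj _ _ (small_conj _ _ (E1 (S (S n))) (E2 (S (S n))))
  (small_conj _ _ (small_conj _ _ HN Hh)
    (small_conj _ _ Hv (gauge_small rho (1 / 20) ltac:(lra)))))).
intros e He [[H1 H2] [[[H3 H3'] H4] [H5 H6]]].
pose proof (gauge_range rho e He) as Hr.
pose proof (gauge_pow_half rho (S n) e He ltac:(lra)).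
pose proof (gauge_pow_half rho n e He ltac:(lra)).
assert (Hhj : forall j, (j <= 3 * m + N + 2)%nat -> 1 <= h e * rho e ^ j).
  intros j Hj; pose proof (gauge_pow_le rho j (3 * m + N + 2) e He Hj).
  pose proof (gauge_pow rho (3 * m + N + 2) e He).
  pose proof (Rinv_0_lt_compat (rho e ^ (3 * m + N + 2)) ltac:(lra)).
  rewrite <- (Rinv_l (rho e ^ (3 * m + N + 2))) by lra.
  apply Rmult_le_compat; lra.
pose proof (gauge_pow rho m e He) as Hm.
pose proof (gauge_pow rho N e He) as HNp.
assert (Ek : exp (k e) = / rho e) by (unfold k; rewrite exp_Ropp, exp_ln by lra; reflexivity).
assert (Hk : 1 + k e <= / rho e) by (rewrite <- Ek; apply exp_ineq1_le).
assert (Hinv : 20 <= / rho e).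
  rewrite <- (Rinv_inv 20); apply Rinv_le_contravar; lra.
assert (Hh0 : 1 <= h e) by (pose proof (Hhj 0%nat ltac:(lia)); simpl in *; lra).
assert (Hhm : / rho e * / rho e <= h e * rho e ^ m).
  pose proof (Hhj (m + 2)%nat ltac:(lia)) as T; rewrite pow_add in T; simpl in T.
  apply Rmult_le_reg_r with (rho e * rho e); [nra|].
  replace (/ rho e * / rho e * (rho e * rho e)) with 1 by (field; lra); lra.
assert (HhN : 1 <= h e * rho e ^ m * rho e ^ N).
  rewrite Rmult_assoc, <- pow_add; apply Hhj; lia.
assert (Main := Rabs_int_ker_diff_le (h e) (rho e ^ m) (k e - x e) (k e + x e) Hm).
assert (Hexp : exp (k e - x e) <= / rho e * / rho e).
  rewrite <- Ek, <- exp_plus; left; apply exp_increasing; lra.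
replace (- (k e + x e)) with (- k e - x e) in Main by ring.
set (I1 := int_ker (h e) (k e - x e)) in *; set (I2 := int_ker (h e) (- k e - x e)) in *.
set (e1 := exp (k e - x e)) in *; set (e2 := exp (- k e - x e)) in *.
assert (Main' : Rabs (e1 * I1 - e2 * I2 - 2 * PI) <= 200 * rho e ^ m * (/ rho e * / rho e)).
  eapply Rle_trans; [apply Main|].
  - rewrite <- pow_mult, Nat.mul_comm; apply Hhj; lia.
  - assert (h e * rho e ^ m * rho e ^ N <= h e * rho e ^ m * (k e - x e)); [|lra].
    apply Rmult_le_compat_l; [nra | lra].
  - assert (h e * rho e ^ m * rho e ^ N <= h e * rho e ^ m * (k e + x e)); [|lra].
    apply Rmult_le_compat_l; [nra | lra].
  - eapply Rle_trans; [|exact Hhm]; nra.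
  - apply Rmult_le_compat_l; [lra | exact Hexp].
assert (Hvm : Rabs (v e) * Rabs (e1 * I1 - e2 * I2 - 2 * PI) <= rho e ^ n / 2).
  pose proof (gauge_pow rho Nv e He); pose proof (gauge_pow rho n e He).
  apply Rle_trans with (/ rho e ^ Nv * (200 * rho e ^ m * (/ rho e * / rho e))).
    apply Rmult_le_compat; auto using Rabs_pos.
  unfold m; rewrite !pow_add.
  replace (/ rho e ^ Nv * _) with (rho e ^ n * (200 * (rho e * rho e))).
    assert (rho e * rho e <= 1 / 20 * (1 / 20)) by (apply Rmult_le_compat; lra); nra.
  simpl; field; split; lra.
assert (HPI : 2 <= 2 * PI) by (pose proof PI2_1; lra).
replace (1 / (2 * PI) * (Y e * I1 - Z e * I2) - v e) with
  (/ (2 * PI) * ((I1 * Y e - I1 * (e1 * v e)) + (- (I2 * Z e - I2 * (e2 * v e))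
    + v e * (e1 * I1 - e2 * I2 - 2 * PI)))) by (field; lra).
rewrite Rabs_mult, (Rabs_pos_eq (/ _)) by (left; apply Rinv_0_lt_compat; lra).
assert (T : Rabs ((I1 * Y e - I1 * (e1 * v e)) + (- (I2 * Z e - I2 * (e2 * v e))
    + v e * (e1 * I1 - e2 * I2 - 2 * PI))) <= rho e ^ n).
  eapply Rle_trans; [apply Rabs_triang|].
  eapply Rle_trans; [apply Rplus_le_compat_l, Rabs_triang|].
  rewrite Rabs_Ropp, (Rabs_mult (v e)); lra.
assert (/ (2 * PI) <= 1) by (rewrite <- Rinv_1; apply Rinv_le_contravar; lra).
assert (0 < / (2 * PI)) by (apply Rinv_0_lt_compat; lra).
pose proof (Rabs_pos ((I1 * Y e - I1 * (e1 * v e)) + (- (I2 * Z e - I2 * (e2 * v e))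
    + v e * (e1 * I1 - e2 * I2 - 2 * PI)))).
nra.
Qed.

Lemma drho_pow (rho : gauge) (q : nat) : (drho rho ^ q)%Rt = cls rho (fun e => rho e ^ q).
Proof.
induction q as [|q IH]; simpl; [reflexivity|].
rewrite IH; unfold drho; apply cls_mul; auto with moderate.
Qed.

Lemma Cmod_le_Rabs (z : C) : Cmod z <= Rabs (Re z) + Rabs (Im z).
Proof.
replace z with (RtoC (Re z) + Ci * RtoC (Im z))%C at 1.
- eapply Rle_trans; [apply Cmod_triangle|].
  rewrite Cmod_mult, !Cmod_R, Cmod_Ci; lra.
- apply injective_projections; simpl; unfold Re, Im; ring.
Qed.

Theorem theorem80 (rho : gauge) (y : Rt rho -> Ct rho) :
  let k := neg_log_drho rho in
  let K := Rt_itv (- k)%Rt k in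
  GSF K y ->
  (forall x, K x -> GSF_derive K y x = y x) ->
  forall x, sharp_interior K x ->
    lim_infty
      (fun h => inv_Fourier h
        (fun w => Delta_bd k y w / (Ct_of_Rt 1%Rt - Ct_i rho * Ct_of_Rt w))%Ct x)
      (y x).
Proof.
intros k K Hy Hode X HX n.
set (ke := fun e => - ln (rho e)).
assert (Mk : moderate rho ke) by (unfold ke; auto with moderate).
assert (Mk' : moderate rho (fun e => - ke e)) by auto with moderate.
assert (EK : K = Rt_itv (cls rho (fun e => - ke e)) (cls rho ke))
  by (rewrite <- cls_opp by exact Mk; reflexivity).
set (fe := defining_net K y).
assert (Hfe : defines K fe y) by (unfold fe, defining_net; apply epsilon_spec; exact Hy).
set (x := repr X).
assert (Mx : moderate rho x) by apply repr_moderate.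
assert (Xx : X = cls rho x) by (symmetry; apply cls_repr).
assert (KX : K X) by (destruct HX as (U & _ & UK & UX); apply UK, UX).
rewrite Xx in HX, KX |- *; clearbody x; clear X Xx.
pose proof HX as HX'; rewrite EK in HX'.
apply sharp_interior_itv in HX'; [|assumption..]; destruct HX' as [N HN].
assert (Hk0 : forall e, 0 < e <= 1 -> 0 <= ke e).
  intros e He; pose proof (gauge_range rho e He); unfold ke.
  pose proof (ln_le (rho e) 1 ltac:(lra) ltac:(lra)); rewrite ln_1 in *; lra.
assert (Hexp : moderate rho (fun e => exp (ke e - - ke e))).
  apply (moderate_le _ _ _ (moderate_inv_gauge_pow rho 2)); intros e He.
  pose proof (gauge_range rho e He).
  apply Req_le; f_equal; unfold ke, Rminus; rewrite Ropp_involutive, exp_plus, exp_Ropp, exp_ln by lra.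
  simpl; field; lra.
assert (Kk : K (cls rho ke) /\ K (cls rho (fun e => - ke e))).
  rewrite EK; split; split; apply cls_le_of_small; trivial; exists 1; split; try lra;
    intros e He; specialize (Hk0 e He); lra.
destruct Kk as [Kk Kk'].
pose proof (defines_smooth_net_Re _ _ _ _ Hfe) as Fr.
pose proof (defines_smooth_net_Im _ _ _ _ Hfe) as Fi.
assert (MF : forall t, moderate rho t -> K (cls rho t) -> cmoderate rho (fun e => fe e (t e))).
  intros t Ht Kt; split; [exact (proj2 Fr t Ht Kt 0%nat) | exact (proj2 Fi t Ht Kt 0%nat)].
assert (Ode : forall t, moderate rho t -> K (cls rho t) ->
    equivalent rho (fun e => Derive_n (fun s => Re (fe e s)) 1 (t e)) (fun e => Re (fe e (t e))) /\
    equivalent rho (fun e => Derive_n (fun s => Im (fe e s)) 1 (t e)) (fun e => Im (fe e (t e)))).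
  intros t Ht Kt; specialize (Hode _ Kt).
  rewrite (proj1 (proj2 Hfe t Ht Kt)) in Hode; unfold GSF_derive in Hode; fold fe in Hode.
  pose proof (equivalent_sym _ _ _ (repr_cls rho t Ht)) as Et.
  pose proof (repr_moderate rho (cls rho t)) as Mt.
  assert (Kt' : K (cls rho (repr (cls rho t)))) by (rewrite cls_repr; exact Kt).
  apply ccls_inj in Hode; [| |apply MF; assumption].
  - destruct Hode as [Hr Hi]; split.
    + eapply equivalent_trans; [|exact Hr].
      exact (smooth_net_equivalent _ _ _ 1 _ _ Fr Ht Mt Et Kt).
    + eapply equivalent_trans; [|exact Hi].
      exact (smooth_net_equivalent _ _ _ 1 _ _ Fi Ht Mt Et Kt).
  - split; [exact (proj2 Fr _ Mt Kt' 1%nat) | exact (proj2 Fi _ Mt Kt' 1%nat)].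
assert (Hab : forall e, 0 < e <= 1 -> - ke e <= ke e)
  by (intros e He; specialize (Hk0 e He); lra).
pose proof (exp_ode_net rho K _ _ _ Mk' Mk Hexp Hab EK Fr (fun t Ht Kt => proj1 (Ode t Ht Kt))) as Sr.
pose proof (exp_ode_net rho K _ _ _ Mk' Mk Hexp Hab EK Fi (fun t Ht Kt => proj2 (Ode t Ht Kt))) as Si.
assert (Sx : small (fun e => - ke e <= x e <= ke e)).
  apply (small_imp _ _ HN); intros e He H; pose proof (gauge_pow rho N e He); lra.
assert (Sk : small (fun e => - ke e <= ke e <= ke e)).
  exists 1; split; [lra|]; intros e He; specialize (Hk0 e He); lra.
assert (Sk' : small (fun e => - ke e <= - ke e <= ke e)).
  exists 1; split; [lra|]; intros e He; specialize (Hk0 e He); lra.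
destruct (MF x Mx KX) as [Mvr Mvi].
(* Precision [rho^{n+1}] for each of the two parts, since their sum must be at most [rho^n]. *)
destruct (inversion_net rho x _ _ _ N (S n) Mx Mvr HN (Sr x ke Sx Sk) (Sr x _ Sx Sk')) as [M1 H1].
destruct (inversion_net rho x _ _ _ N (S n) Mx Mvi HN (Si x ke Sx Sk) (Si x _ Sx Sk')) as [M2 H2].
fold ke in H1, H2.
(* The extra power compensates for the slack [rho^0 = 1] in comparing representatives: [rho^{-(M+1)}
   - 1 >= 2 rho^{-M} - 1 >= rho^{-M}] with [M = M1 + M2]. *)
exists (cls rho (fun e => / rho e ^ S (M1 + M2))); intros H HH.
rewrite <- (cls_repr rho H) in HH; pose proof (repr_moderate rho H) as Mh.
apply small_le_of_cls with (m := 0%nat) in HH; [|auto with moderate..].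
assert (Hh : forall j, (j <= M1 + M2)%nat -> small (fun e => / rho e ^ j <= repr H e)).
  intros j Hj; apply (small_imp _ _ (small_conj _ _ HH (gauge_half rho))).
  intros e He [H3 H4]; pose proof (gauge_pow_half rho (M1 + M2) e He H4) as G.
  pose proof (gauge_pow rho (M1 + M2) e He) as G1.
  pose proof (gauge_pow rho (S (M1 + M2)) e He) as G2.
  pose proof (gauge_pow_le rho j (M1 + M2) e He Hj).
  set (u := rho e ^ (M1 + M2)) in *; set (w := rho e ^ S (M1 + M2)) in *; simpl in H3.
  assert (/ rho e ^ j <= / u) by (apply Rinv_le_contravar; lra).
  assert (1 <= / u) by (rewrite <- Rinv_1; apply Rinv_le_contravar; lra).
  assert (2 * / u <= / w).
    replace (2 * / u) with (/ (u / 2)) by (field; lra); apply Rinv_le_contravar; lra.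
  lra.
pose proof (H1 _ Mh (Hh M1 ltac:(lia))) as A1; pose proof (H2 _ Mh (Hh M2 ltac:(lia))) as A2.
change k with (cls rho ke).
rewrite (inv_Fourier_bd rho y (fun e => fe e (ke e)) (fun e => fe e (- ke e)) ke x H);
  try assumption.
2, 3: apply MF; assumption.
2: exact (proj1 (proj2 Hfe ke Mk Kk)).
2: rewrite cls_opp by exact Mk; exact (proj1 (proj2 Hfe _ Mk' Kk')).
2: apply (small_imp _ _ (Hh 0%nat ltac:(lia))); intros e _; simpl; rewrite Rinv_1; trivial.
rewrite (proj1 (proj2 Hfe x Mx KX)).
pose proof (moderate_int_ker rho (repr H) (fun e => ke e - x e) Mh) as MIp.
pose proof (moderate_int_ker rho (repr H) (fun e => - ke e - x e) Mh) as MIq.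
destruct (MF ke Mk Kk) as [MY MY'], (MF _ Mk' Kk') as [MZ MZ'].
assert (MW : cmoderate rho (fun e =>
    (1 / (2 * PI) * (Re (fe e (ke e)) * int_ker (repr H e) (ke e - x e)
       - Re (fe e (- ke e)) * int_ker (repr H e) (- ke e - x e)),
     1 / (2 * PI) * (Im (fe e (ke e)) * int_ker (repr H e) (ke e - x e)
       - Im (fe e (- ke e)) * int_ker (repr H e) (- ke e - x e))))).
  split; simpl; apply (moderate_mul rho (fun _ => 1 / (2 * PI))); auto with moderate.
rewrite ccls_sub by (trivial; apply MF; assumption).
assert (MD := cmoderate_sub _ _ _ MW (MF x Mx KX)).
destruct MD as [MD MD'].
rewrite ccls_abs, drho_pow by assumption.
apply cls_le_of_small; [apply moderate_Cmod; assumption | auto with moderate|].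
apply (small_imp _ _ (small_conj _ _ (small_conj _ _ A1 A2) (gauge_half rho))).
intros e He [[H3 H4] H5]; pose proof (gauge_pow_half rho n e He H5).
eapply Rle_trans; [apply Cmod_le_Rabs|].
eapply Rle_trans; [apply Rplus_le_compat; [exact H3 | exact H4] | lra].
Qed.
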